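(* Let $\epsilon^*>0$ and consider the singularly perturbed linear-quadratic optimal control problem $\mathbf{P}$ and its dual problem $\mathbf{D}$ defined in the context, under the standing assumptions listed there. Then the optimal value $V_{\mathbf P}(\epsilon)$ of $\mathbf{P}$ and the optimal value $V_{\mathbf D}(\epsilon)$ of $\mathbf{D}$ satisfy $$V_{\mathbf P}(\epsilon)=V_{\mathbf D}(\epsilon)\qquad\text{for every }\epsilon\in(0,\epsilon^*].$$
   Context: Notation. $m,n,k$ are positive integers, $\epsilon^*>0$. $W^{1,2}([0,1];\mathbb{R}^d)$ is the Sobolev space of absolutely continuous functions on $[0,1]$ with square-integrable derivative. For $\epsilon>0$, $I^{\epsilon}=\begin{bmatrix} I_m & 0 \\ 0 & \epsilon I_n\end{bmatrix}$ and $I^{1/\epsilon}=(I^{\epsilon})^{-1}$, where $I_j$ is the $j\times j$ identity. The data are matrices depending on $(t,\epsilon)\in[0,1]\times[0,\epsilon^*]$: $Q=\begin{bmatrix} Q_{11} & Q_{12} \\ Q_{21} & Q_{22}\end{bmatrix}\in\mathbb{R}^{(m+n)\times(m+n)}$, $R\in\mathbb{R}^{k\times k}$, $A=\begin{bmatrix} A_{11} & A_{12} \\ A_{21} & A_{22}\end{bmatrix}$ with $A_{11}\in\mathbb{R}^{m\times m}$, $A_{22}\in\mathbb{R}^{n\times n}$, and $b=\begin{bmatrix} b_1 \\ b_2\end{bmatrix}$ with $b_1\in\mathbb{R}^{m\times k}$, $b_2\in\mathbb{R}^{n\times k}$; a matrix $\pi(\epsilon)\in\mathbb{R}^{(m+n)\times(m+n)}$;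 and an initial vector $z_0(\epsilon)\in\mathbb{R}^{m+n}$. Primal problem $\mathbf{P}$ (for each fixed $\epsilon\in(0,\epsilon^*]$): minimise $$J_{\mathbf P}(\hat z,\hat u,\epsilon)=\frac12\int_0^1\left(\hat z^TQ\hat z+\hat u^TR\hat u\right)dt+\frac12\hat z(1,\epsilon)^T\pi(\epsilon)\hat z(1,\epsilon)$$ over $\hat z\in W^{1,2}([0,1];\mathbb{R}^{m+n})$, $\hat u\in W^{1,2}([0,1];\mathbb{R}^k)$ (functions of $t$) subject to $I^{\epsilon}\frac{d\hat z}{dt}=A\hat z+b\hat u$ on $[0,1]$ and $\hat z(0,\epsilon)=z_0(\epsilon)$. The feasible set is assumed nonempty. $V_{\mathbf P}(\epsilon)$ denotes the minimum value, i.e. the value of $J_{\mathbf P}$ at the optimal control (which exists and is unique). Dual problem $\mathbf{D}$ (for each fixed $\epsilon\in(0,\epsilon^*]$): maximise $$J_{\mathbf D}(\hat\rho,\hat\gamma,\epsilon)=\frac12\int_0^1\left(-\hat\rho^TQ^{-1}\hat\rho-\hat\gamma^TbR^{-1}b^T\hat\gamma\right)dt-\hat\gamma(0,\epsilon)^TI^{\epsilon}z_0(\epsilon)-\frac12\hat\gamma(1,\epsilon)^TI^{\epsilon}\pi(\epsilon)^{-1}I^{\epsilon}\hat\gamma(1,\epsilon)$$ over $\hat\rho,\hat\gamma\in W^{1,2}([0,1];\mathbb{R}^{m+n})$ subject to $I^{\epsilon}\frac{d\hat\gamma}{dt}=-A^T\hat\gamma+\hat\rho$ on $[0,1]$ (no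 boundary conditions on $\hat\gamma$). $V_{\mathbf D}(\epsilon)$ denotes the optimal (maximum) value of $\mathbf D$. Standing assumptions. (a) $A_{22}$ is negative definite for all $t\in[0,1]$, $\epsilon\in[0,\epsilon^*]$. (b) For each fixed $\epsilon\in[0,\epsilon^*]$, $Q,R,A_{ij},b_i$ are smooth in $t\in[0,1]$. (c) $Q,R,\pi,A_{ij},b_i$ have asymptotic power series expansions in $\epsilon$ as $\epsilon\to0$, valid over their respective domains; a superscript $0$ denotes the leading ($\epsilon^0$) term. (d) $R$ is symmetric positive definite for all $t\in[0,1]$, $\epsilon\in[0,\epsilon^*]$. (e) $\pi(\epsilon)=\begin{bmatrix} \pi_{11}(\epsilon) & \epsilon\pi_{12}(\epsilon) \\ \epsilon\pi_{12}(\epsilon)^T & \epsilon\pi_{22}(\epsilon)\end{bmatrix}$ with $\pi_{11}\in\mathbb{R}^{m\times m}$, $\pi_{22}\in\mathbb{R}^{n\times n}$. (f) $Q$ is symmetric positive definite for all $t\in[0,1]$, $\epsilon\in[0,\epsilon^*]$; $\pi(\epsilon)$ is symmetric, positive semi-definite for $\epsilon\in[0,\epsilon^*]$ and positive definite for $\epsilon\in(0,\epsilon^*]$. (g) For every $t\in[0,1]$, the eigenvalues of $G(t)=\begin{bmatrix} A_{22}^0(t) & -b_2^0(t)R^0(t)^{-1}b_2^0(t)^T \\ -Q_{22}^0(t) & -A_{22}^0(t)^T\end{bmatrix}$ have non-zero real parts. (h) There is a non-singular matrix $T(t)=\begin{bmatrix} T_{11}(t) & T_{12}(t) \\ T_{21}(t)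 & T_{22}(t)\end{bmatrix}$ ($n\times n$ blocks) with $T(t)^{-1}G(t)T(t)=\begin{bmatrix} -\Lambda(t) & 0 \\ 0 & \Lambda(t)\end{bmatrix}$, all eigenvalues of $\Lambda(t)$ having positive real parts on $[0,1]$, and such that $T_{11}(0)$ and $T_{22}(1)-\pi_{22}^0T_{12}(1)$ are non-singular. *)

(* Defs.v *)
From HB Require Import structures.
From mathcomp Require Import all_boot all_order all_algebra.
From mathcomp Require Import all_classical all_reals all_analysis.
From mathcomp.real_closed Require Import complex.

Set Implicit Arguments.
Unset Strict Implicit.
Unset Printing Implicit Defensive.

Import Order.TTheory GRing.Theory Num.Theory.
Import numFieldNormedType.Exports.

Local Open Scope classical_set_scope.
Local Open Scope ring_scope.

(** * Functions on the unit interval *)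

(* Functions on [0,1] are functions on R of which only the values on [0,1]
   are used. *)

Definition abs_continuous01 (R : realType) (f : R -> R) : Prop :=
  forall e : R, 0 < e -> exists2 d : R, 0 < d &
    forall (p : nat) (x y : 'I_p -> R),
      (forall i, [/\ 0 <= x i, x i <= y i & y i <= 1]) ->
      (forall i j, i != j -> y i <= x j \/ y j <= x i) ->
      \sum_(i < p) (y i - x i) < d ->
      \sum_(i < p) `|f (y i) - f (x i)| < e.

(* derive1 f is meaningful only where f is derivable; for an
   absolutely continuous f this is almost everywhere in [0,1]. *)
Definition sobolev12 (R : realType) (f : R -> R) : Prop :=
  [/\ abs_continuous01 f,
      {ae @lebesgue_measure R, forall t : R, t \in `[0, 1] -> derivable f t 1},
      measurable_fun `[(0 : R), 1] (derive1 f) &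
      (@lebesgue_measure R).-integrable `[(0 : R), 1]
        (fun t : R => ((derive1 f t) ^+ 2)%:E)].

Definition W12 (R : realType) (d : nat) (f : R -> 'cV[R]_d) : Prop :=
  forall i, sobolev12 (fun t => f t i 0).

Definition ddt (R : realType) (d : nat) (f : R -> 'cV[R]_d) (t : R) :
    'cV[R]_d :=
  \col_i derive1 (fun s => f s i 0) t.

(* Smoothness on the closed interval [0,1]: restriction of a C^oo function. *)
Definition smooth01 (R : realType) (f : R -> R) : Prop :=
  exists2 g : R -> R, (forall (l : nat) (t : R), derivable (derive1n l g) t 1) &
    forall t : R, t \in `[0, 1] -> f t = g t.

Definition smooth01_mx (R : realType) (p q : nat) (M : R -> 'M[R]_(p, q)) :
    Prop :=
  forall i j, smooth01 (fun t => M t i j).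

(** * Matrices *)

Definition dotmul (R : realType) (d : nat) (x y : 'cV[R]_d) : R :=
  (x^T *m y) 0 0.

Definition qform (R : realType) (d : nat) (M : 'M[R]_d) (x : 'cV[R]_d) : R :=
  dotmul x (M *m x).

Definition symmetric_mx (R : realType) (d : nat) (M : 'M[R]_d) : Prop :=
  M^T = M.

(* No symmetry is included in the following three notions. *)
Definition posdef (R : realType) (d : nat) (M : 'M[R]_d) : Prop :=
  forall x : 'cV[R]_d, x != 0 -> 0 < qform M x.

Definition possemidef (R : realType) (d : nat) (M : 'M[R]_d) : Prop :=
  forall x : 'cV[R]_d, 0 <= qform M x.

Definition negdef (R : realType) (d : nat) (M : 'M[R]_d) : Prop :=
  forall x : 'cV[R]_d, x != 0 -> qform M x < 0.

Definition complex_eigenvalue (R : realType) (d : nat) (M : 'M[R]_d)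
    (l : R[i]) : Prop :=
  eigenvalue (map_mx (real_complex R) M) l.

(** * Asymptotic expansions *)

(* f(t,e) ~ \sum_l e^l c_l(t) as e -> 0 in [0,es], uniformly in t in [0,1].
   The value e = 0 is included, so that f(t,0) = c_0(t). *)
Definition has_expansion (R : realType) (p q : nat) (es : R)
    (f : R -> R -> 'M[R]_(p, q)) (c : nat -> R -> 'M[R]_(p, q)) : Prop :=
  forall N : nat, exists C d : R, 0 < d /\
    forall t e : R, t \in `[0, 1] -> e \in `[0, es] -> e <= d ->
      forall i j,
        `|(f t e - \sum_(l < N.+1) e ^+ l *: c l t) i j| <= C * e ^+ N.+1.

(** * The control problem *)

(* First argument t, second argument e (epsilon) where both are present. *)
Record lq_data (R : realType) (m n k : nat) := LqData {
  dQ : R -> R -> 'M[R]_(m + n);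
  dR : R -> R -> 'M[R]_k;
  dA : R -> R -> 'M[R]_(m + n);
  db : R -> R -> 'M[R]_(m + n, k);
  dpi11 : R -> 'M[R]_m;
  dpi12 : R -> 'M[R]_(m, n);
  dpi22 : R -> 'M[R]_n;
  dz0 : R -> 'cV[R]_(m + n)
}.

(* Coefficients of the expansions in e; index 0 is the leading term. *)
Record lq_coefs (R : realType) (m n k : nat) := LqCoefs {
  cQ : nat -> R -> 'M[R]_(m + n);
  cR : nat -> R -> 'M[R]_k;
  cA : nat -> R -> 'M[R]_(m + n);
  cb : nat -> R -> 'M[R]_(m + n, k);
  cpi11 : nat -> 'M[R]_m;
  cpi12 : nat -> 'M[R]_(m, n);
  cpi22 : nat -> 'M[R]_n
}.

Section Problem.
Variables (R : realType) (m n k : nat).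
Implicit Types (D : lq_data R m n k) (K : lq_coefs R m n k) (e : R).

Local Notation mu := (@lebesgue_measure R).

(* The block structure prescribed for the terminal weight pi. *)
Definition dpi D e : 'M[R]_(m + n) :=
  block_mx (dpi11 D e) (e *: dpi12 D e)
           (e *: (dpi12 D e)^T) (e *: dpi22 D e).

Definition Ieps e : 'M[R]_(m + n) := block_mx 1%:M 0 0 e%:M.

Definition primal_feasible D e (z : R -> 'cV[R]_(m + n)) (u : R -> 'cV[R]_k) :
    Prop :=
  [/\ W12 z, W12 u,
      {ae mu, forall t : R, t \in `[0, 1] ->
        Ieps e *m ddt z t = dA D t e *m z t + db D t e *m u t} &
      z 0 = dz0 D e].

Definition primal_cost D e (z : R -> 'cV[R]_(m + n)) (u : R -> 'cV[R]_k) : R :=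
  2^-1 * (\int[mu]_(t in `[(0 : R), 1])
            (qform (dQ D t e) (z t) + qform (dR D t e) (u t)))
  + 2^-1 * qform (dpi D e) (z 1).

Definition dual_feasible D e (rho gam : R -> 'cV[R]_(m + n)) : Prop :=
  [/\ W12 rho, W12 gam &
      {ae mu, forall t : R, t \in `[0, 1] ->
        Ieps e *m ddt gam t = - (dA D t e)^T *m gam t + rho t}].

Definition dual_cost D e (rho gam : R -> 'cV[R]_(m + n)) : R :=
  2^-1 * (\int[mu]_(t in `[(0 : R), 1])
            (- qform (invmx (dQ D t e)) (rho t)
             - qform (db D t e *m invmx (dR D t e) *m (db D t e)^T) (gam t)))
  - dotmul (gam 0) (Ieps e *m dz0 D e)
  - 2^-1 * qform (Ieps e *m invmx (dpi D e) *m Ieps e) (gam 1).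

(* v is the value V_P(e): the minimum of the primal cost, attained. *)
Definition primal_value D e (v : R) : Prop :=
  (exists z u, primal_feasible D e z u /\ primal_cost D e z u = v) /\
  (forall z u, primal_feasible D e z u -> v <= primal_cost D e z u).

(* v is the value V_D(e): the maximum of the dual cost, attained. *)
Definition dual_value D e (v : R) : Prop :=
  (exists rho gam, dual_feasible D e rho gam /\ dual_cost D e rho gam = v) /\
  (forall rho gam, dual_feasible D e rho gam -> dual_cost D e rho gam <= v).

Definition boundary_layer_mx K (t : R) : 'M[R]_(n + n) :=
  let A22 := drsubmx (cA K 0 t) in
  let b2 := dsubmx (cb K 0 t) in
  block_mx A22 (- (b2 *m invmx (cR K 0 t) *m b2^T))
           (- drsubmx (cQ K 0 t)) (- A22^T).

Record standing_assumptions (es : R) D K : Prop := StandingAssumptions {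
  sa_a : forall (t e : R), t \in `[0, 1] -> e \in `[0, es] ->
    negdef (drsubmx (dA D t e));
  sa_b : forall e, e \in `[0, es] ->
    [/\ smooth01_mx (dQ D ^~ e), smooth01_mx (dR D ^~ e),
        smooth01_mx (dA D ^~ e) & smooth01_mx (db D ^~ e)];
  sa_c : [/\ has_expansion es (dQ D) (cQ K), has_expansion es (dR D) (cR K),
             has_expansion es (dA D) (cA K) & has_expansion es (db D) (cb K)];
  sa_c_pi :
    [/\ has_expansion es (fun=> dpi11 D) (fun l => fun=> cpi11 K l),
        has_expansion es (fun=> dpi12 D) (fun l => fun=> cpi12 K l) &
        has_expansion es (fun=> dpi22 D) (fun l => fun=> cpi22 K l)];
  sa_d : forall (t e : R), t \in `[0, 1] -> e \in `[0, es] ->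
    symmetric_mx (dR D t e) /\ posdef (dR D t e);
  sa_f_Q : forall (t e : R), t \in `[0, 1] -> e \in `[0, es] ->
    symmetric_mx (dQ D t e) /\ posdef (dQ D t e);
  sa_f_pi : forall e, e \in `[0, es] ->
    symmetric_mx (dpi D e) /\ possemidef (dpi D e);
  sa_f_pi_pos : forall e, e \in `]0, es] -> posdef (dpi D e);
  sa_g : forall (t : R) (l : R[i]), t \in `[0, 1] ->
    complex_eigenvalue (boundary_layer_mx K t) l -> complex.Re l != 0;
  sa_h : exists (T : R -> 'M[R]_(n + n)) (L : R -> 'M[R]_n),
    [/\ forall t : R, t \in `[0, 1] ->
          T t \in unitmx /\
          invmx (T t) *m boundary_layer_mx K t *m T t
            = block_mx (- L t) 0 0 (L t),
        forall (t : R) (l : R[i]), t \in `[0, 1] ->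
          complex_eigenvalue (L t) l -> 0 < complex.Re l,
        ulsubmx (T 0) \in unitmx &
        drsubmx (T 1) - cpi22 K 0 *m ursubmx (T 1) \in unitmx]
}.

End Problem.

(* Main.v *)
Require Import Defs.
From mathcomp Require Import all_boot all_order all_algebra.
From mathcomp Require Import all_classical all_reals all_analysis.
From mathcomp Require Import measurable_realfun ring lra.

Set Implicit Arguments.
Unset Strict Implicit.
Unset Printing Implicit Defensive.

Import Order.TTheory GRing.Theory Num.Theory.
Import numFieldNormedType.Exports.

Local Open Scope classical_set_scope.
Local Open Scope ring_scope.

(** The state and costate equations are adjoint to each other, so that along a
feasible pair (z, u) of the primal problem and a feasible pair (rho, gam) of
the dual one the scalar gam . E z, with E the diagonal matrix of the problem,
has derivative rho . z + (B^T gam) . u almost everywhere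
([adjoint_pairing]).  Integrating this identity turns twice the difference of
the two costs into an integral of Fenchel-Young gaps
  x . S x + y . S^-1 y - 2 x . y = (x - S^-1 y) . S (x - S^-1 y)
for the weights Q and R, plus one such gap for the terminal weight pi at t = 1
([duality_gap]).  The gaps are nonnegative, which is weak duality
([weak_duality]), and they vanish exactly when
  rho = Q z,  R u = B^T gam,  E gam(1) = - pi z(1)
([tight_duality]).  It therefore suffices to exhibit one pair of feasible arcs
with these properties: it is optimal on both sides with equal costs.

Eliminating u and rho leaves a linear two-point boundary value problem for
(z, gam): the Hamiltonian system with z(0) = z0 and E gam(1) = - pi z(1).  In
terms of a fundamental matrix of the system this is a square linear equation,
solvable as soon as the homogeneous problem has only the zero solution.  For a
homogeneous solution the adjoint pairing reads
  - z(1) . pi z(1) = integral of z . Q z + u . R u >= 0,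
which forces z(1) = 0, hence gam(1) = 0, hence the solution to vanish
([homogeneous_extremal], [extremal_exists]).  Since the parameter is positive, E
is invertible and the system is an ordinary differential equation.

Two analytic facts carry the argument.  Fundamental matrices exist for
continuous coefficients, by Picard iteration, and are invertible, because the
adjoint system provides an inverse ([fundamental_matrix]).  An absolutely
continuous function whose derivative is almost everywhere equal to a continuous
function is the integral of the latter ([weak_FTC]); since states, controls and
multipliers are themselves absolutely continuous, the right-hand side of the
adjoint pairing is continuous and this form of the fundamental theorem of
calculus is the one needed. *)

(** * Calculus on a compact interval *)

Section Calculus.
Context {R : realType}.
Implicit Types (f g h : R -> R) (A : set R) (a b t : R).

Lemma within_cst A (c : R) : {within A, continuous (fun _ : R => c)}.
Proof. by move=> x; apply: cvg_cst. Qed.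

Lemma within_add A f g : {within A, continuous f} -> {within A, continuous g} ->
  {within A, continuous (fun t => f t + g t)}.
Proof. by move=> cf cg x; apply: cvgD; [exact: cf|exact: cg]. Qed.

Lemma within_opp A f : {within A, continuous f} ->
  {within A, continuous (fun t => - f t)}.
Proof. by move=> cf x; apply: cvgN; exact: cf. Qed.

Lemma within_mul A f g : {within A, continuous f} -> {within A, continuous g} ->
  {within A, continuous (fun t => f t * g t)}.
Proof. by move=> cf cg x; apply: cvgM; [exact: cf|exact: cg]. Qed.

Lemma within_inv A f : {within A, continuous f} -> (forall t, A t -> f t != 0) ->
  {within A, continuous (fun t => (f t)^-1)}.
Proof.
move=> cf f0; apply/subspace_continuousP => x Ax; apply: cvgV; first exact: f0.
by move/subspace_continuousP : cf; apply.
Qed.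

Lemma within_sum (I : Type) (r : seq I) (P : pred I) A (f : I -> R -> R) :
  (forall i, {within A, continuous (f i)}) ->
  {within A, continuous (fun t => \sum_(i <- r | P i) f i t)}.
Proof.
move=> cf; elim: r => [|i r IH].
  by under eq_fun do rewrite big_nil; exact: within_cst.
under eq_fun do rewrite big_cons.
by case: (P i) => //; exact: within_add.
Qed.

Lemma within_eq A f g : {in A, f =1 g} -> {within A, continuous f} ->
  {within A, continuous g}.
Proof. exact: subspace_eq_continuous. Qed.

Lemma within_bounded a b f : {within `[a, b], continuous f} ->
  exists2 K : R, 0 <= K & forall t, t \in `[a, b] -> `|f t| <= K.
Proof.
move=> cf; have [ab|ba] := leP a b; last first.
  exists 0 => // t; rewrite in_itv/= => /andP[at_ tb].
  by have := le_lt_trans (le_trans at_ tb) ba; rewrite ltxx.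
have cn : {within `[a, b], continuous (fun t => `|f t|)}.
  by move=> x; apply: cvg_norm; exact: cf.
have [c _ fc] := EVT_max ab cn.
by exists `|f c|.
Qed.

Lemma is_derive_const t (c : R) : is_derive t 1 (fun _ : R => c) 0.
Proof. exact: is_derive_cst. Qed.

Lemma is_derive_add t f g (df dg : R) : is_derive t 1 f df ->
  is_derive t 1 g dg -> is_derive t 1 (fun s => f s + g s) (df + dg).
Proof. exact: is_deriveD. Qed.

Lemma is_derive_opp t f (df : R) : is_derive t 1 f df ->
  is_derive t 1 (fun s => - f s) (- df).
Proof. exact: is_deriveN. Qed.

Lemma is_derive_mul t f g (df dg : R) : is_derive t 1 f df ->
  is_derive t 1 g dg -> is_derive t 1 (fun s => f s * g s) (f t * dg + df * g t).
Proof. by move=> Df Dg; rewrite [df * _]mulrC; exact: is_deriveM. Qed.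

Lemma is_derive_bigsum (I : Type) (r : seq I) (P : pred I) t
    (f : I -> R -> R) (df : I -> R) :
  (forall i, is_derive t 1 (f i) (df i)) ->
  is_derive t 1 (fun s => \sum_(i <- r | P i) f i s) (\sum_(i <- r | P i) df i).
Proof.
move=> Df; elim: r => [|i r IH].
  by under eq_fun do rewrite big_nil; rewrite big_nil; exact: is_derive_const.
under eq_fun do rewrite big_cons.
by rewrite big_cons; case: (P i) => //; exact: is_derive_add.
Qed.

Lemma is_derive_derivable t f (df : R) : is_derive t 1 f df -> derivable f t 1.
Proof. by case. Qed.

Lemma is_derive_derive1 t f (df : R) : is_derive t 1 f df -> derive1 f t = df.
Proof. by move=> Df; rewrite derive1E derive_val. Qed.

Lemma derivable_is_derive1 t f : derivable f t 1 -> is_derive t 1 f (derive1 f t).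
Proof. by move=> Df; rewrite derive1E; exact: derivableP. Qed.

Lemma is_derive_within a b f df :
  (forall t, t \in `[a, b] -> is_derive t 1 f (df t)) ->
  {within `[a, b], continuous f}.
Proof.
move=> Df; apply: derivable_within_continuous => t tab.
exact: is_derive_derivable (Df t tab).
Qed.

(** Both [g - f] and [g + f] have a nonnegative derivative. *)
Lemma derive_dominated a b f g df dg :
  {within `[a, b], continuous f} -> {within `[a, b], continuous g} ->
  (forall t, t \in `]a, b[ -> is_derive t 1 f (df t)) ->
  (forall t, t \in `]a, b[ -> is_derive t 1 g (dg t)) ->
  (forall t, t \in `]a, b[ -> `|df t| <= dg t) ->
  `|f a| <= g a -> forall t, t \in `[a, b] -> `|f t| <= g t.
Proof.
move=> cf cg Df Dg dfg fga t tab.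
have aab : a \in `[a, b].
  by move: tab; rewrite !in_itv/= => /andP[ta tb]; rewrite lexx (le_trans ta).
have at_ : a <= t by move: tab; rewrite in_itv/= => /andP[].
have key (h dh : R -> R) : {within `[a, b], continuous h} ->
    (forall t, t \in `]a, b[ -> is_derive t 1 h (dh t)) ->
    (forall t, t \in `]a, b[ -> 0 <= dh t) -> 0 <= h a -> 0 <= h t.
  move=> ch Dh dh0 h0; apply: (le_trans h0).
  apply: (@ger0_derive1_le_cc _ h a b) => //.
  - by move=> x /Dh/is_derive_derivable.
  - by move=> x xab; rewrite (is_derive_derive1 (Dh x xab)) dh0.
rewrite ler_norml; move: fga; rewrite ler_norml => /andP[fa1 fa2].
apply/andP; split.
- rewrite lerNl -subr_ge0 opprK.
  apply: (key (fun s => g s + f s) (fun s => dg s + df s)).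
  + exact: within_add.
  + by move=> s sab; apply: is_derive_add; [exact: Dg|exact: Df].
  + by move=> s /dfg; rewrite ler_norml => /andP[]; lra.
  + by lra.
- rewrite -subr_ge0.
  apply: (key (fun s => g s + - f s) (fun s => dg s + - df s)).
  + by apply: within_add => //; exact: within_opp.
  + by move=> s sab; apply: is_derive_add; [exact: Dg|apply: is_derive_opp; exact: Df].
  + by move=> s /dfg; rewrite ler_norml => /andP[]; lra.
  + by lra.
Qed.

Lemma derive_zero_cst a b f : {within `[a, b], continuous f} ->
  (forall t, t \in `]a, b[ -> is_derive t 1 f 0) ->
  forall t, t \in `[a, b] -> f t = f a.
Proof.
move=> cf Df t tab; apply/eqP; rewrite -subr_eq0 -normr_le0.
apply: (@derive_dominated a b (fun s => f s - f a)
  (fun=> 0) (fun=> 0 + - 0) (fun=> 0)) => //.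
- by apply: within_add => //; exact: within_cst.
- exact: within_cst.
- move=> s sab; exact: is_derive_add (Df s sab)
    (is_derive_opp (is_derive_const _ _)).
- by move=> s _; rewrite oppr0 addr0 normr0.
- by rewrite subrr normr0.
Qed.

Lemma within_integrable a b f : {within `[a, b], continuous f} ->
  (@lebesgue_measure R).-integrable `[a, b] (EFin \o f).
Proof.
by move=> cf; apply: continuous_compact_integrable => //; exact: segment_compact.
Qed.

Definition primitive a f (x : R) : R :=
  \int[lebesgue_measure]_(t in `[a, x]) f t.

Lemma primitive_continuous a b f : a <= b -> {within `[a, b], continuous f} ->
  {within `[a, b], continuous (primitive a f)}.
Proof.
by move=> ab cf; apply: parameterized_integral_continuous => //;
  exact: within_integrable.
Qed.

Lemma primitive_start a f : primitive a f a = 0.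
Proof. by rewrite /primitive set_itv1 Rintegral_set1. Qed.

Lemma is_derive_primitive a b f t : {within `[a, b], continuous f} ->
  t \in `]a, b[ -> is_derive t 1 (primitive a f) (f t).
Proof.
move=> cf tab.
have [ta tb] : a < t /\ t < b by move: tab; rewrite in_itv/= => /andP[].
have cft : {for t, continuous f}.
  exact: within_continuous_continuous (lt_trans ta tb) cf tab.
have [D1 D2] := continuous_FTC1_closed tb (within_integrable cf) ta cft.
by rewrite -D2; exact: derivable_is_derive1.
Qed.

Lemma integral_derive a b f F : a < b -> {within `[a, b], continuous f} ->
  {within `[a, b], continuous F} ->
  (forall t, t \in `]a, b[ -> is_derive t 1 F (f t)) ->
  (\int[lebesgue_measure]_(t in `[a, b]) f t)%R = F b - F a.
Proof.
move=> ab cf cF DF; rewrite /Rintegral (@continuous_FTC2 _ f F a b ab cf)//.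
- by have /(continuous_within_itvP _ ab)[? ? ?] := cF; split => // t /DF/is_derive_derivable.
- by move=> t /DF/is_derive_derive1.
Qed.

End Calculus.

Section UniformLimits.
Context {R : realType}.
Implicit Types (f : R -> R) (a b t c x : R).

Lemma le_geometric_half c x : (forall n, x <= c * 2^-1 ^+ n) -> x <= 0.
Proof.
move=> H; rewrite leNgt; apply/negP => x0.
have h : (c * 2^-1 ^+ n : R) @[n --> \oo] --> c * 0.
  by apply: cvgMr; apply: cvg_expr; rewrite ger0_norm; lra.
rewrite mulr0 in h.
have [n _ /(_ n (leqnn n))/=] := cvgr_lt _ h _ x0.
by rewrite ltNge H.
Qed.

Lemma eq_geometric_half c x y : (forall n, `|x - y| <= c * 2^-1 ^+ n) -> x = y.
Proof.
by move=> /le_geometric_half; rewrite normr_le0 subr_eq0 => /eqP.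
Qed.

(** The bound on the remainder depends on [c] alone: applied at every point of a
set it is the Weierstrass test for uniform convergence. *)
Lemma series_geometric_limit c (u : nat -> R) :
  (forall k, `|u k| <= c * 2^-1 ^+ k) ->
  exists l, forall n, `|l - \sum_(k < n) u k| <= 2 * c * 2^-1 ^+ n.
Proof.
move=> uc; pose S n := \sum_(k < n) u k.
have c0 : 0 <= c by have := uc 0; rewrite expr0 mulr1; apply: le_trans.
have SE n p : `|S (n + p)%N - S n| <= 2 * c * (2^-1 ^+ n - 2^-1 ^+ (n + p)).
  elim: p => [|p IH]; first by rewrite addn0 !subrr normr0 mulr0.
  rewrite addnS {1}/S big_ord_recr/= -/(S _).
  have := uc (n + p)%N; rewrite exprS.
  set x := _ ^+ (n + p) in IH *; move: IH; set s := S (n + p)%N => IH H.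
  rewrite (_ : s + _ - S n = (s - S n) + u (n + p)%N); last by ring.
  apply: (le_trans (ler_normD _ _)); apply: (le_trans (lerD IH H)); lra.
have Sb n p : `|S (n + p)%N - S n| <= 2 * c * 2^-1 ^+ n.
  apply: (le_trans (SE n p)); apply: ler_wpM2l; first by lra.
  by rewrite gerBl exprn_ge0// invr_ge0.
have cS : cvgn S.
  have -> : S = series u by apply/funext => n; rewrite seriesEord.
  apply: normed_cvg.
  apply: (@series_le_cvg _ _ (geometric c 2^-1)) => //=.
  - by move=> n; rewrite mulr_ge0// exprn_ge0// invr_ge0.
  - by apply: is_cvg_geometric_series; rewrite ger0_norm; lra.
exists (limn S) => n; rewrite ler_distl -/(S n); apply/andP; split.
- apply: limr_ge => //; exists n => // p /= np.
  by have := Sb n (p - n)%N; rewrite subnKC// ler_distl => /andP[].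
- apply: limr_le => //; exists n => // p /= np.
  by have := Sb n (p - n)%N; rewrite subnKC// ler_distl => /andP[].
Qed.

Lemma within_uniform_limit a b c f (s : nat -> R -> R) :
  (forall n, {within `[a, b], continuous (s n)}) ->
  (forall n t, t \in `[a, b] -> `|f t - s n t| <= c * 2^-1 ^+ n) ->
  {within `[a, b], continuous f}.
Proof.
move=> cs fs; apply/subspace_continuousP => t tab.
apply/cvgrPdist_le => /= e e0.
have [n ne] : exists n, c * 2^-1 ^+ n <= e / 3.
  apply: contrapT => /forallNP H.
  have e30 : 0 < e / 3 by rewrite divr_gt0.
  suff : e / 3 <= 0 by rewrite leNgt e30.
  by apply: (@le_geometric_half c) => n; apply/ltW; rewrite ltNge; apply/negP/H.
have /subspace_continuousP/(_ t tab)/cvgrPdist_le/(_ (e / 3)) := cs n.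
rewrite divr_gt0// => /(_ isT) near_s; near=> x.
have xab : x \in `[a, b] by near: x; exact: withinT.
have stx : `|s n t - s n x| <= e / 3 by near: x; exact: near_s.
have ft := le_trans (fs n t tab) ne; have fx := le_trans (fs n x xab) ne.
rewrite (_ : f t - f x = (f t - s n t) + (s n t - s n x) - (f x - s n x)); last by ring.
apply: (le_trans (ler_normB _ _)); have := ler_normD (f t - s n t) (s n t - s n x).
move: ft fx stx; lra.
Unshelve. all: by end_near. Qed.

End UniformLimits.

(** * Linear differential equations *)

Section LinearODE.
Context {R : realType}.
Variables (N : nat) (a b : R).
Hypothesis ab : a < b.

Lemma within_mulmx (A : set R) p q r (X : R -> 'M[R]_(p, q)) (Y : R -> 'M[R]_(q, r)) :
  (forall i j, {within A, continuous (fun t => X t i j)}) ->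
  (forall i j, {within A, continuous (fun t => Y t i j)}) ->
  forall i j, {within A, continuous (fun t => (X t *m Y t) i j)}.
Proof.
move=> cX cY i j; under eq_fun do rewrite mxE.
by apply: within_sum => l; exact: within_mul.
Qed.

Lemma within_bounded_mx p q (X : R -> 'M[R]_(p, q)) :
  (forall i j, {within `[a, b], continuous (fun t => X t i j)}) ->
  exists2 K : R, 0 <= K & forall t i j, t \in `[a, b] -> `|X t i j| <= K.
Proof.
move=> cX.
have /choice[K HK] : forall ij : 'I_p * 'I_q, exists K : R, 0 <= K /\
    forall t, t \in `[a, b] -> `|X t ij.1 ij.2| <= K.
  by move=> ij; have [K K0 HK] := within_bounded (cX ij.1 ij.2); exists K.
exists (\sum_ij K ij); first by apply: sumr_ge0 => ij _; have [] := HK ij.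
move=> t i j tab; have [_ /(_ t tab) H] := HK (i, j).
apply: (le_trans H); rewrite (bigD1 (i, j))//= lerDl.
by apply: sumr_ge0 => ij _; have [] := HK ij.
Qed.

Variable M : R -> 'M[R]_N.
Hypothesis cM : forall i j, {within `[a, b], continuous (fun t => M t i j)}.

(** The terms of the Peano-Baker series of [M] based at [a]; their sum is the
solution that equals the identity at [a]. *)
Fixpoint picard (k : nat) : R -> 'M[R]_N :=
  if k is k'.+1 then
    fun t => \matrix_(i, j) primitive a (fun s => (M s *m picard k' s) i j) t
  else fun=> 1%:M.

Lemma picardSE k i j : (fun t => picard k.+1 t i j) =
  primitive a (fun s => (M s *m picard k s) i j).
Proof. by apply/funext => t; rewrite mxE. Qed.

Lemma picard_continuous k i j :
  {within `[a, b], continuous (fun t => picard k t i j)}.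
Proof.
elim: k i j => [|k IH] i j; first exact: within_cst.
rewrite picardSE.
by apply: primitive_continuous; [exact: ltW|exact: within_mulmx].
Qed.

Lemma is_derive_picardS k i j t : t \in `]a, b[ ->
  is_derive t 1 (fun s => picard k.+1 s i j) ((M t *m picard k t) i j).
Proof.
move=> tab; rewrite picardSE.
apply: (is_derive_primitive (b := b)) => //.
exact: within_mulmx cM (@picard_continuous k) i j.
Qed.

Lemma picard_start k i j : picard k.+1 a i j = 0.
Proof. by rewrite /= mxE primitive_start. Qed.

Lemma mulmx_entry_le p (X Y : 'M[R]_p) (K y : R) i j : 0 <= K ->
  (forall l, `|X i l| <= K) -> (forall l, `|Y l j| <= y) ->
  `|(X *m Y) i j| <= p%:R * K * y.
Proof.
move=> K0 HX HY; rewrite mxE; apply: (le_trans (ler_norm_sum _ _ _)).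
rewrite (_ : p%:R * K * y = \sum_(l < p) (K * y)); last first.
  by rewrite sumr_const card_ord -mulrA mulr_natl.
by apply: ler_sum => l _; rewrite normrM ler_pM.
Qed.

(** With the weight [expR (2 * C * (t - a))], where [C] bounds the operator
[X |-> M *m X] entrywise, each integration against [M] halves the bound. *)
Lemma picard_bound : exists W : R, forall k t i j, t \in `[a, b] ->
  `|picard k t i j| <= W * 2^-1 ^+ k.
Proof.
have [K K0 MK] := within_bounded_mx cM.
pose C : R := N%:R * K; have C0 : 0 <= C by rewrite mulr_ge0.
pose w (t : R) : R := expR (2 * C * (t - a)).
have Dw (c t : R) : is_derive t 1 (fun s => c * w s) (c * (2 * C * w t)).
  have D1 : is_derive t 1 (fun s : R => 2 * C * (s - a)) (2 * C).
    have := is_derive_mul (is_derive_const t (2 * C))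
      (is_derive_add (is_derive_id t (1 : R)) (is_derive_const t (- a))).
    by rewrite addr0 mulr1 mul0r addr0.
  have D2 := @is_derive1_comp R (@expR R) (fun s => 2 * C * (s - a)) t _ _
    (is_derive_expR _) D1.
  have := is_derive_mul (is_derive_const t c) D2.
  by rewrite mul0r addr0 [_ * (2 * C)]mulrC.
have w1 t : a <= t -> 1 <= w t.
  by move=> at_; rewrite -expR0 ler_expR mulr_ge0// ?mulr_ge0// subr_ge0.
have key k t i j : t \in `[a, b] -> `|picard k t i j| <= 2^-1 ^+ k * w t.
  elim: k t i j => [|k IH] t i j tab.
    rewrite expr0 mul1r mxE; apply: (@le_trans _ _ 1); last first.
      by apply: w1; move: tab; rewrite in_itv/= => /andP[].
    by case: (i == j); rewrite ?normr1 ?normr0.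
  apply: (@derive_dominated _ a b (fun s => picard k.+1 s i j)
    (fun s => 2^-1 ^+ k.+1 * w s) (fun s => (M s *m picard k s) i j)
    (fun s => 2^-1 ^+ k.+1 * (2 * C * w s))) => //.
  - exact: picard_continuous.
  - by apply: is_derive_within => s _; exact: Dw.
  - by move=> s sab; exact: is_derive_picardS.
  - move=> s sab; have sab' := subset_itv_oo_cc sab.
    apply: (le_trans (mulmx_entry_le K0 (fun l => MK s i l sab')
      (fun l => IH s l j sab'))).
    by rewrite -/C exprS; lra.
  - by rewrite picard_start normr0 mulr_ge0 ?exprn_ge0 ?invr_ge0// expR_ge0.
exists (w b) => k t i j tab; apply: (le_trans (key k t i j tab)).
rewrite mulrC ler_wpM2r// ?exprn_ge0 ?invr_ge0// ler_expR ler_wpM2l// ?mulr_ge0//.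
by rewrite lerB//; move: tab; rewrite in_itv/= => /andP[].
Qed.

(** The uniform limit [P] of the partial sums is only known to be continuous.  The
function [G = 1 + integral of M P] is derivable, and the partial sums converge
to [G] as well, so that [P = G] and [G] solves the equation. *)
Theorem linear_ode_solution : exists Phi : R -> 'M[R]_N,
  [/\ forall i j, {within `[a, b], continuous (fun t => Phi t i j)},
      Phi a = 1%:M &
      forall t i j, t \in `]a, b[ ->
        is_derive t 1 (fun s => Phi s i j) ((M t *m Phi t) i j)].
Proof.
have [W HW] := picard_bound.
pose S n t := \sum_(k < n) picard k t.
have SE n t i j : S n t i j = \sum_(k < n) picard k t i j by rewrite summxE.
have SfE n i j : (fun t => S n t i j) = fun t => \sum_(k < n) picard k t i j.
  by apply/funext => t; exact: SE.
have /choice[phi Hphi] : forall tij : R * ('I_N * 'I_N), exists l : R,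
    tij.1 \in `[a, b] ->
    forall n, `|l - S n tij.1 tij.2.1 tij.2.2| <= 2 * W * 2^-1 ^+ n.
  move=> [t [i j]] /=; have [tab|_] := boolP (t \in `[a, b]); last by exists 0.
  have [l Hl] := series_geometric_limit (fun k => HW k t i j tab).
  by exists l => _ n; rewrite SE.
pose P t : 'M[R]_N := \matrix_(i, j) phi (t, (i, j)).
have HP n t i j : t \in `[a, b] -> `|P t i j - S n t i j| <= 2 * W * 2^-1 ^+ n.
  by move=> tab; rewrite mxE; exact: (Hphi (t, (i, j))).
have cS n i j : {within `[a, b], continuous (fun t => S n t i j)}.
  by rewrite SfE; apply: within_sum => k; exact: picard_continuous.
have cP i j : {within `[a, b], continuous (fun t => P t i j)}.
  apply: (within_uniform_limit (fun n => cS n i j)) => n t tab; exact: HP.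
have cMP := within_mulmx cM cP.
pose G t : 'M[R]_N :=
  \matrix_(i, j) ((i == j)%:R + primitive a (fun s => (M s *m P s) i j) t).
have GE i j : (fun t => G t i j) = fun t =>
    (i == j)%:R + primitive a (fun s => (M s *m P s) i j) t.
  by apply/funext => t; rewrite mxE.
have cG i j : {within `[a, b], continuous (fun t => G t i j)}.
  rewrite GE; apply: within_add; first exact: within_cst.
  by apply: primitive_continuous; first exact: ltW.
have DG t i j : t \in `]a, b[ ->
    is_derive t 1 (fun s => G s i j) ((M t *m P t) i j).
  move=> tab; rewrite GE -[_ (M t *m P t) _ _]add0r.
  exact: is_derive_add (is_derive_const _ _) (is_derive_primitive (cMP i j) tab).
have DS n t i j : t \in `]a, b[ ->
    is_derive t 1 (fun s => S n.+1 s i j) ((M t *m S n t) i j).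
  move=> tab; rewrite mulmx_sumr summxE -[X in is_derive _ _ _ X]add0r.
  rewrite SfE; under eq_fun do rewrite big_ord_recl.
  apply: is_derive_add (is_derive_const _ _) _.
  by apply: is_derive_bigsum => k; exact: is_derive_picardS.
have [K K0 MK] := within_bounded_mx cM.
have PG t i j : t \in `[a, b] -> P t i j = G t i j.
  move=> tab.
  pose D : R := N%:R * K * (2 * W).
  have SG n : `|S n.+1 t i j - G t i j| <= D * 2^-1 ^+ n * (t - a).
    apply: (@derive_dominated _ a b (fun s => S n.+1 s i j + - G s i j)
      (fun s => D * 2^-1 ^+ n * (s - a))
      (fun s => (M s *m S n s) i j + - (M s *m P s) i j)
      (fun s => D * 2^-1 ^+ n)) => //.
    - by apply: within_add => //; apply: within_opp.
    - apply: within_mul; first exact: within_cst.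
      apply: within_add; last exact: within_cst.
      by apply: continuous_subspaceT => x; exact: cvg_id.
    - move=> s sab; exact: is_derive_add (DS n s i j sab)
        (is_derive_opp (DG s i j sab)).
    - move=> s sab.
      have := is_derive_mul (is_derive_const s (D * 2^-1 ^+ n))
        (is_derive_add (is_derive_id s (1 : R)) (is_derive_const s (- a))).
      by rewrite addr0 mulr1 mul0r addr0.
    - move=> s sab; have sab' := subset_itv_oo_cc sab.
      rewrite distrC (_ : _ - _ = (M s *m (P s - S n s)) i j); last first.
        by rewrite mulmxBr !mxE.
      rewrite /D -mulrA; apply: mulmx_entry_le => // l; first exact: MK.
      by rewrite mxE [X in _ + X]mxE; exact: HP.
    - rewrite subrr mulr0 normr_le0 subr_eq0 SE big_ord_recl big1/=; last first.
        by move=> k _; rewrite picard_start.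
      by rewrite addr0 !mxE primitive_start addr0.
  have at_ : 0 <= t - a by rewrite subr_ge0; move: tab; rewrite in_itv/= => /andP[].
  apply: (@eq_geometric_half _ (W + D * (t - a))) => n.
  have h1 := HP n.+1 t i j tab; have h2 := SG n.
  rewrite (_ : P t i j - _ = (P t i j - S n.+1 t i j) +
    (S n.+1 t i j - G t i j)); last by ring.
  apply: (le_trans (ler_normD _ _)); move: (lerD h1 h2) => /le_trans; apply.
  by rewrite exprS; lra.
exists G; split => //.
- by apply/matrixP => i j; rewrite mxE primitive_start addr0 mxE.
- move=> t i j tab; suff -> : G t = P t by exact: DG.
  by apply/matrixP => k l; rewrite PG//; exact: subset_itv_oo_cc.
Qed.

End LinearODE.

Section FundamentalMatrix.
Context {R : realType}.

(** Precomposition with [clamp] extends a function given on [0, 1] to the whole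
line, so that primitives have two-sided derivatives at 0 and 1. *)
Definition clamp (t : R) : R := Order.max 0 (Order.min 1 t).

Lemma clamp_itv t : clamp t \in `[0, 1].
Proof. by rewrite in_itv/= /clamp le_max lexx/= ge_max ler01 ge_min lexx. Qed.

Lemma clamp_id t : t \in `[0, 1] -> clamp t = t.
Proof.
by rewrite in_itv/= => /andP[t0 t1]; rewrite /clamp (min_idPr t1) (max_idPr t0).
Qed.

Lemma clamp_continuous : continuous clamp.
Proof.
move=> t; apply: continuous_max; first exact: cvg_cst.
by apply: continuous_min; [exact: cvg_cst|exact: cvg_id].
Qed.

Lemma continuous_clamp (f : R -> R) : {within `[0, 1], continuous f} ->
  continuous (fun t => f (clamp t)).
Proof.
move=> /subspace_continuousP cf t.
apply: (@cvg_comp _ _ _ clamp f _ (within `[0, 1] (nbhs (clamp t)))); last first.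
  by apply: cf; exact: clamp_itv.
move=> P HP; have H : \forall s \near t, `[0, 1]%classic (clamp s) -> P (clamp s).
  exact: clamp_continuous HP.
apply: (@filterS _ (nbhs t) _ _ (clamp @^-1` P) _ H) => s /=; apply; exact: clamp_itv.
Qed.

Lemma unit_itv_sub t : t \in `[(0 : R), 1] -> t \in `](-1), 2[.
Proof. by rewrite !in_itv/= => /andP[? ?]; apply/andP; split; lra. Qed.

(** Let [P] solve [P' = M P] and [X] solve the adjoint equation [X' = - M^T X], both
equal to the identity at -1.  The derivative of [X^T P] vanishes, so [X^T] is an
inverse of [P]. *)
Lemma fundamental_matrix N (M : R -> 'M[R]_N) :
  (forall i j, {within `[0, 1], continuous (fun t => M t i j)}) ->
  exists Phi : R -> 'M[R]_N, forall t, t \in `[0, 1] ->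
    Phi t \in unitmx /\
    forall i j, is_derive t 1 (fun s => Phi s i j) ((M t *m Phi t) i j).
Proof.
move=> cM; pose M' t := M (clamp t).
have cM' i j : {within `[(-1), 2], continuous (fun t => M' t i j)}.
  by apply: continuous_subspaceT; exact: continuous_clamp (cM i j).
pose M'' t := - (M' t)^T.
have cM'' i j : {within `[(-1), 2], continuous (fun t => M'' t i j)}.
  have -> : (fun t => M'' t i j) = fun t => - M' t j i.
    by apply/funext => t; rewrite !mxE.
  exact: within_opp.
have lt12 : -1 < 2 :> R by lra.
have [P [cP P1 DP]] := linear_ode_solution lt12 cM'.
have [X [cX X1 DX]] := linear_ode_solution lt12 cM''.
have XP t : t \in `[(-1), 2] -> (X t)^T *m P t = 1%:M.
  move=> t12; rewrite -(mulmx1 1%:M) -{1}(trmx1 R N) -{1}X1 -P1.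
  apply/matrixP => i j; rewrite !mxE.
  under eq_bigr do rewrite mxE; under [RHS]eq_bigr do rewrite mxE.
  apply: (@derive_zero_cst _ _ 2 (fun s => \sum_l X s l i * P s l j)) => //.
    by apply: within_sum => l; exact: within_mul.
  move=> s s12.
  rewrite [X in is_derive _ _ _ X](_ : _ =
    \sum_l (X s l i * (M' s *m P s) l j + (M'' s *m X s) l i * P s l j)); last first.
    rewrite big_split/= (_ : \sum_i0 _ = ((X s)^T *m (M' s *m P s)) i j); last first.
      by rewrite [RHS]mxE; apply: eq_bigr => l _; rewrite [X in _ = X * _]mxE.
    rewrite (_ : \sum_i0 _ = ((M'' s *m X s)^T *m P s) i j); last first.
      by rewrite [RHS]mxE; apply: eq_bigr => l _; rewrite [X in _ = X * _]mxE.
    rewrite trmx_mul /M'' linearN/= trmxK mulmxN mulNmx [X in _ = _ + X]mxE mulmxA.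
    by rewrite subrr.
  apply: is_derive_bigsum => l.
  exact: is_derive_mul (DX s l i s12) (DP s l j s12).
exists P => t t01; split.
  by have [] := mulmx1_unit (XP t (subset_itv_oo_cc (unit_itv_sub t01))).
move=> i j; rewrite -{2}(clamp_id t01).
exact: DP (unit_itv_sub t01).
Qed.

End FundamentalMatrix.

(** * Absolutely continuous functions *)

Section AbsolutelyContinuous.
Context {R : realType}.
Implicit Types (f g h F : R -> R) (x y t : R).

Lemma abs_continuous_within f : abs_continuous01 f ->
  {within `[0, 1], continuous f}.
Proof.
move=> acf; apply/subspace_continuousP => t t01.
apply/cvgrPdist_lt => e e0; have [d d0 H] := acf e e0.
have {}H (x y : R) : 0 <= x -> x <= y -> y <= 1 -> y - x < d -> `|f y - f x| < e.
  move=> x0 xy y1 yxd; have := H 1%N (fun=> x) (fun=> y).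
  by rewrite !big_ord1; apply=> // i j; rewrite !ord1.
move: t01; rewrite /= in_itv/= => /andP[t0 t1].
near=> s.
have : s \in `[0, 1] by near: s; exact: withinT.
have : `|t - s| < d.
  near: s; apply: cvg_within.
  by exists d.
rewrite in_itv/= ltr_norml => /andP[ds sd] /andP[s0 s1].
have [st|ts] := leP s t; first by apply: H.
by rewrite distrC; apply: H => //; lra.
Unshelve. all: by end_near. Qed.

Lemma abs_continuous_bounded f : abs_continuous01 f ->
  exists2 K : R, 0 < K & forall t, 0 <= t -> t <= 1 -> `|f t| <= K.
Proof.
move=> /abs_continuous_within/within_bounded[K K0 H]; exists (K + 1); first by lra.
by move=> t t0 t1; apply: (@le_trans _ _ K); [apply: H; rewrite in_itv/= t0|lra].
Qed.

Lemma abs_continuous_lipschitz f (K : R) :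
  (forall x y, 0 <= x -> x <= y -> y <= 1 -> `|f y - f x| <= K * (y - x)) ->
  abs_continuous01 f.
Proof.
move=> H e e0; have K1 : 0 < `|K| + 1 by have := normr_ge0 K; lra.
exists (e / (`|K| + 1)); first by rewrite divr_gt0.
move=> p x y xy _ sd; apply: (@le_lt_trans _ _ (\sum_(i < p) (`|K| + 1) * (y i - x i))).
  apply: ler_sum => i _; have [x0 xyi y1] := xy i.
  apply: (le_trans (H _ _ x0 xyi y1)); apply: ler_wpM2r; first by rewrite subr_ge0.
  by have := ler_norm K; lra.
by rewrite -mulr_sumr mulrC -ltr_pdivlMr.
Qed.

Lemma abs_continuous_derive f df :
  (forall t : R, t \in `[0, 1] -> is_derive t 1 f (df t)) ->
  {within `[0, 1], continuous df} -> abs_continuous01 f.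
Proof.
move=> Df cdf; have [K K0 dfK] := within_bounded cdf.
apply: (@abs_continuous_lipschitz _ K) => x y x0 xy y1.
have xy01 : `[x, y] `<=` `[(0 : R), 1] by apply: subset_itvScc; rewrite bnd_simp.
have xy01' s : s \in `]x, y[ -> s \in `[0, 1].
  by move=> /subset_itv_oo_cc sxy; exact: xy01.
have [c cxy ->] := MVT_segment xy (fun s sxy => Df s (xy01' s sxy))
  (continuous_subspaceW xy01 (is_derive_within Df)).
rewrite normrM [X in _ * X]ger0_norm ?subr_ge0// ler_wpM2r ?subr_ge0//.
exact: dfK (xy01 _ cxy).
Qed.

Lemma abs_continuous_add f g : abs_continuous01 f -> abs_continuous01 g ->
  abs_continuous01 (fun t => f t + g t).
Proof.
move=> acf acg e e0; have e2 : 0 < e / 2 by lra.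
have [d1 d10 H1] := acf _ e2; have [d2 d20 H2] := acg _ e2.
exists (Order.min d1 d2); first by rewrite lt_min d10.
move=> p x y xy dis; rewrite lt_min => /andP[s1 s2].
have := ltrD (H1 _ _ _ xy dis s1) (H2 _ _ _ xy dis s2).
rewrite -big_split/= -splitr; apply: le_lt_trans; apply: ler_sum => i _.
rewrite (_ : f (y i) + g (y i) - _ = (f (y i) - f (x i)) + (g (y i) - g (x i))).
  exact: ler_normD.
by ring.
Qed.

Lemma abs_continuous_cst (c : R) : abs_continuous01 (fun=> c).
Proof.
by apply: (@abs_continuous_lipschitz _ 0) => x y _ _ _; rewrite subrr normr0 mul0r.
Qed.

Lemma abs_continuous_mul f g : abs_continuous01 f -> abs_continuous01 g ->
  abs_continuous01 (fun t => f t * g t).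
Proof.
move=> acf acg e e0.
have [K K0 fK] := abs_continuous_bounded acf.
have [L L0 gL] := abs_continuous_bounded acg.
have eK : 0 < e / 2 / K by rewrite !divr_gt0.
have eL : 0 < e / 2 / L by rewrite !divr_gt0.
have [d1 d10 H1] := acf _ eL; have [d2 d20 H2] := acg _ eK.
exists (Order.min d1 d2); first by rewrite lt_min d10.
move=> p x y xy dis; rewrite lt_min => /andP[s1 s2].
have := H1 _ _ _ xy dis s1; rewrite ltr_pdivlMr// => h1.
have := H2 _ _ _ xy dis s2; rewrite ltr_pdivlMr// => h2.
have := ltrD h1 h2; rewrite -splitr !mulr_suml -big_split/=; apply: le_lt_trans.
apply: ler_sum => i _; have [x0 xyi y1] := xy i.
rewrite (_ : f (y i) * g (y i) - _ =
  (f (y i) - f (x i)) * g (y i) + (g (y i) - g (x i)) * f (x i)); last by ring.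
apply: (le_trans (ler_normD _ _)); rewrite !normrM; apply: lerD.
  by apply: ler_wpM2l => //; apply: gL => //; exact: le_trans xyi.
by apply: ler_wpM2l => //; apply: fK => //; exact: le_trans y1.
Qed.

Lemma abs_continuous_sum (I : Type) (r : seq I) (P : pred I) (f : I -> R -> R) :
  (forall i, abs_continuous01 (f i)) ->
  abs_continuous01 (fun t => \sum_(i <- r | P i) f i t).
Proof.
move=> acf; elim: r => [|i r IH].
  rewrite (_ : (fun _ => _) = fun=> 0); first exact: abs_continuous_cst.
  by apply/funext => t; rewrite big_nil.
case Pi: (P i); last first.
  by rewrite (_ : (fun _ => _) = fun t => \sum_(i <- r | P i) f i t)//;
    apply/funext => t; rewrite big_cons Pi.
rewrite (_ : (fun _ => _) = fun t => f i t + \sum_(i <- r | P i) f i t).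
  exact: abs_continuous_add.
by apply/funext => t; rewrite big_cons Pi.
Qed.

(** Cousin's lemma in the form of an induction principle on intervals: a property of
intervals that is additive and holds for all short intervals around each point
holds for [0, 1].  The proof considers the supremum of the [s] with [P 0 s]. *)
Lemma cousin (P : R -> R -> Prop) :
  (forall x y z, x <= y -> y <= z -> P x y -> P y z -> P x z) ->
  (forall t, 0 <= t -> t <= 1 -> exists2 d : R, 0 < d &
     forall x y, 0 <= x -> x <= t -> t <= y -> y <= 1 -> y - x < d -> P x y) ->
  P 0 1.
Proof.
move=> Padd Ploc.
pose S := [set s : R | [/\ 0 <= s, s <= 1 & P 0 s]].
have S0 : S 0.
  have [d d0 H] := Ploc 0 (lexx _) ler01.
  by split => //; apply: H => //; rewrite subrr.
have Sub : ubound S 1 by move=> s [].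
have supS : has_sup S by split; [exists 0|exists 1].
have Sle s : S s -> s <= sup S by move=> Ss; exact: (sup_upper_bound supS).
have s0 : 0 <= sup S by apply: Sle.
have s1 : sup S <= 1 by apply: ge_sup => //; exists 0.
have [d d0 H] := Ploc _ s0 s1.
have [s [s_0 s_1 Ps] sd] := sup_adherent d0 supS.
have ss : s <= sup S by apply: Sle.
pose y := Order.min 1 (sup S + (s - (sup S - d)) / 2).
have ygt : sup S <= y by rewrite le_min s1/=; lra.
have y1 : y <= 1 by rewrite ge_min lexx.
have yd : y <= sup S + (s - (sup S - d)) / 2 by rewrite ge_min lexx orbT.
have Py : P 0 y.
  apply: (Padd 0 s y) => //; first exact: le_trans ygt.
  by apply: H => //; lra.
have : y <= sup S by apply: Sle => //; split => //; exact: le_trans ygt.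
rewrite ge_min => /orP[s1'|]; last by lra.
suff <- : y = 1 by [].
by apply/eqP; rewrite eq_le y1/= (le_trans s1').
Qed.

End AbsolutelyContinuous.

Section WeakFTC.
Context {R : realType}.
Local Notation mu := (@lebesgue_measure R).
Implicit Types (f g h F : R -> R) (x y t : R).

Lemma is_derive_near t F (l e : R) : is_derive t 1 F l -> 0 < e ->
  exists2 d : R, 0 < d &
    forall s, `|s - t| < d -> `|F s - F t - l * (s - t)| <= e * `|s - t|.
Proof.
move=> [dF <-] e0.
have /cvgrPdist_le/(_ e e0)/nbhs_ballP[d /= d0 H] := dF.
exists d => // s std; have [->|st] := eqVneq s t.
  by rewrite !subrr mulr0 subrr normr0 mulr0.
have hn0 : s - t != 0 by rewrite subr_eq0.
have /H/(_ hn0) : ball_ Num.norm 0 d (s - t) by rewrite /ball_/= sub0r normrN.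
rewrite /= /derive [_ *: 1]mulr1 subrK => H1.
rewrite -ler_pdivrMr ?normr_gt0// -normf_div -normrN.
apply: (le_trans _ H1); rewrite le_eqVlt; apply/orP; left; apply/eqP; congr (`| _ |).
by rewrite /GRing.scale/=; field.
Qed.

(** The invariant used with [cousin] below.  Up to a slope [e], the increment of [F]
over [x, y] is controlled by its increments over finitely many nonoverlapping
intervals whose total length is at most the measure of [U] inside [x, y]; the
half-open interval makes that measure additive. *)
Lemma gauge_additive (U : set R) F (e : R) :
  let P x y := exists l : seq (R * R),
    [/\ all (fun p => (x <= p.1) && (p.1 <= p.2) && (p.2 <= y)) l,
        pairwise (fun p q : R * R => p.2 <= q.1) l,
        ((\sum_(p <- l) (p.2 - p.1))%:E <= mu (U `&` `]x, y]))%E &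
        `|F y - F x| <= e * (y - x) + \sum_(p <- l) `|F p.2 - F p.1|] in
  measurable U ->
  forall x y z, x <= y -> y <= z -> P x y -> P y z -> P x z.
Proof.
move=> P mU x y z xy yz [l1 [a1 p1 m1 f1]] [l2 [a2 p2 m2 f2]].
exists (l1 ++ l2); split.
- rewrite all_cat; apply/andP; split.
    by apply: sub_all a1 => p /andP[-> py]; exact: le_trans py yz.
  by apply: sub_all a2 => p /andP[/andP[yp ->] ->]; rewrite (le_trans xy yp).
- rewrite pairwise_cat p1 p2 !andbT; apply/allrelP => p q /(allP a1)/andP[_ py].
  by move=> /(allP a2)/andP[/andP[yq _] _]; exact: le_trans py yq.
- rewrite big_cat/= EFinD (_ : U `&` `]x, z] =
    (U `&` `]x, y]) `|` (U `&` `]y, z])); last first.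
    rewrite -setIUr; congr (_ `&` _).
    by rewrite -itv_bndbnd_setU// bnd_simp.
  rewrite measureU.
  + exact: leeD.
  + exact: measurableI.
  + exact: measurableI.
  + rewrite setIACA (_ : `]x, y] `&` `]y, z] = set0) ?setI0//.
    apply/seteqP; split => // s [] /=; rewrite !in_itv/= => /andP[_ sy] /andP[ys _].
    by have := lt_le_trans ys sy; rewrite ltxx.
- rewrite big_cat/= (_ : F z - F x = (F y - F x) + (F z - F y)); last by ring.
  apply: (le_trans (ler_normD _ _)); move: f1 f2.
  set s1 := \sum_(_ <- l1) _; set s2 := \sum_(_ <- l2) _; lra.
Qed.

Lemma abs_continuous_seq F : abs_continuous01 F -> forall e : R, 0 < e ->
  exists2 d : R, 0 < d & forall l : seq (R * R),
    all (fun p => (0 <= p.1) && (p.1 <= p.2) && (p.2 <= 1)) l ->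
    pairwise (fun p q : R * R => p.2 <= q.1) l ->
    \sum_(p <- l) (p.2 - p.1) < d -> \sum_(p <- l) `|F p.2 - F p.1| < e.
Proof.
move=> acF e e0; have [d d0 H] := acF e e0; exists d => // l al pl sl.
pose n0 : R * R := (0, 0).
have := H (size l) (fun i => (nth n0 l i).1) (fun i => (nth n0 l i).2).
rewrite (big_nth n0) big_mkord; apply.
- by move=> i; have /andP[/andP[-> ->] ->] := allP al _ (mem_nth n0 (ltn_ord i)).
- move/(pairwiseP n0) : pl => pl i j; rewrite neq_lt => /orP[ij|ji]; [left|right];
    apply: pl => //;
    by rewrite inE.
- by move: sl; rewrite (big_nth n0) big_mkord.
Qed.

(** Cover the exceptional null set by an open set [U] of small measure.  Around a
point outside the null set the increments of [F] have slope at most [e / 2];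
small intervals around a point of the null set lie in [U] and are collected in the
list, over which absolute continuity bounds the sum of the increments. *)
Lemma abs_continuous_null_derivative F : abs_continuous01 F ->
  {ae mu, forall t : R, t \in `[0, 1] -> is_derive t 1 F 0} -> F 1 = F 0.
Proof.
move=> acF [N [mN N0 HN]].
apply/eqP; rewrite -subr_eq0 -normr_le0; apply/ler_addgt0Pl => e e0.
have e2 : 0 < e / 2 by lra.
have [d d0 Hd] := abs_continuous_seq acF e2.
have [|U [oU NU mUN]] := lebesgue_regularity_outer mN _ d0.
  by change (mu N < +oo)%E; rewrite N0.
have mU : measurable U by exact: open_measurable.
have muU : (mu U < d%:E)%E.
  rewrite (_ : U = N `|` (U `\` N)); last by rewrite setDUK.
  apply: (le_lt_trans (measureU2 _ _ _)) => //; first exact: measurableD.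
  by rewrite [X in (X + _)%E](_ : _ = 0%E)// add0e.
have [] := cousin (gauge_additive (F := F) (e := e / 2) mU).
  move=> t t0 t1; have [tN|tN] := pselect (N t).
    have /nbhs_ballP[r /= r0 Hr] := open_nbhs_nbhs (conj oU (NU _ tN)).
    exists r => // x y x0 xt ty y1 yx.
    exists [:: (x, y)]; split => //=.
    - by rewrite !lexx (le_trans xt ty).
    - rewrite big_seq1/= (_ : U `&` _ = `]x, y]%classic); last first.
        apply/setIidPr => s /=; rewrite in_itv/= => /andP[xs sy].
        by apply: Hr; rewrite /ball/= ltr_norml; apply/andP; split; lra.
      rewrite lebesgue_measure_itv/= lte_fin; case: ltP => [xy|yx0].
        by rewrite EFinB.
      by rewrite lee_fin; lra.
    - by rewrite big_seq1/= lerDr mulr_ge0//; [lra|rewrite subr_ge0 (le_trans xt ty)].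
  have t01 : t \in `[0, 1] by rewrite in_itv/= t0.
  have Dt : is_derive t 1 F 0.
    by apply: contrapT => nD; apply: tN; apply: HN => /= H; apply: nD; exact: H.
  have [r r0 Hr] := is_derive_near Dt e2.
  exists r => // x y x0 xt ty y1 yx.
  exists [::]; split => //=.
    by rewrite big_nil measure_ge0.
  rewrite big_nil addr0.
  have xr : `|x - t| < r by rewrite ler0_norm; lra.
  have yr : `|y - t| < r by rewrite ger0_norm; lra.
  have := Hr x xr; have := Hr y yr; rewrite !mul0r !subr0.
  rewrite [`|x - t|]ler0_norm ?[`|y - t|]ger0_norm; [|lra|lra].
  rewrite !ler_norml => /andP[? ?] /andP[? ?]; apply/andP; split; lra.
move=> l [al pl ml fl]; have {}ml : \sum_(p <- l) (p.2 - p.1) < d.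
  rewrite -lte_fin; apply: le_lt_trans ml _; apply: le_lt_trans muU.
  by apply: le_measure; rewrite ?inE//; exact: measurableI.
have := Hd l al pl ml; move: fl; rewrite subr0 mulr1; lra.
Qed.

(** The continuous function [g] has a primitive [G] with [G' = g] everywhere on
[0, 1], and [h - G] is absolutely continuous with derivative 0 almost
everywhere. *)
Lemma weak_FTC h g : abs_continuous01 h -> {within `[0, 1], continuous g} ->
  {ae mu, forall t : R, t \in `[0, 1] -> is_derive t 1 h (g t)} ->
  (\int[mu]_(t in `[(0 : R), 1]) g t)%R = h 1 - h 0.
Proof.
move=> ach cg Dh; pose g' t := g (clamp t).
have cg' : {within `[(-1), 2], continuous g'}.
  by apply: continuous_subspaceT; exact: continuous_clamp.
pose G := primitive (-1) g'.
have DG t : t \in `[0, 1] -> is_derive t 1 G (g t).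
  move=> t01; rewrite -[in g t](clamp_id t01).
  exact: (is_derive_primitive cg' (unit_itv_sub t01)).
have cG := is_derive_within DG.
have acG := abs_continuous_derive DG cg.
have DG' t : t \in `]0, 1[ -> is_derive t 1 G (g t) by move=> /subset_itv_oo_cc/DG.
have IG := integral_derive ltr01 cg cG DG'.
rewrite IG.
suff : h 1 + - 1 * G 1 = h 0 + -1 * G 0 by lra.
apply: (@abs_continuous_null_derivative (fun t => h t + - 1 * G t)).
  by apply: abs_continuous_add => //; apply: abs_continuous_mul => //;
    exact: abs_continuous_cst.
apply: filterS Dh; first exact: (ae_filter_ringOfSetsType mu).
move=> t Dh t01.
have := is_derive_add (Dh t01) (is_derive_mul (is_derive_const t (-1)) (DG t t01)).
by rewrite mul0r addr0 mulN1r subrr.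
Qed.

End WeakFTC.

(** * Continuously differentiable curves *)

Section ContinuouslyDifferentiable.
Context {R : realType}.
Implicit Types (f g : R -> R).
Local Notation mu := (@lebesgue_measure R).

(** Only the values on [0, 1] matter, yet the representative [g] has a two-sided
derivative at the end points. This makes the class stable under operations,
such as matrix inversion, that are well behaved on [0, 1] only. *)
Definition C1_on01 f : Prop := exists g dg : R -> R,
  [/\ forall t : R, t \in `[0, 1] -> f t = g t,
      forall t : R, t \in `[0, 1] -> is_derive t 1 g (dg t) &
      {within `[0, 1], continuous dg}].

Lemma C1_eq f g : (forall t : R, t \in `[0, 1] -> f t = g t) -> C1_on01 g -> C1_on01 f.
Proof.
by move=> fg [h [dh [gh Dh ch]]]; exists h, dh; split => // t t01; rewrite fg// gh.
Qed.

Lemma C1_within f : C1_on01 f -> {within `[0, 1], continuous f}.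
Proof.
move=> [g [dg [fg Dg _]]]; apply: (@within_eq _ _ g).
  by move=> t; rewrite inE/= => t01; rewrite fg.
exact: is_derive_within Dg.
Qed.

Lemma C1_cst (c : R) : C1_on01 (fun=> c).
Proof.
by exists (fun=> c), (fun=> 0); split => // [t _|];
  [exact: is_derive_const|exact: within_cst].
Qed.

Lemma C1_add f g : C1_on01 f -> C1_on01 g -> C1_on01 (fun t => f t + g t).
Proof.
move=> [f1 [df [ff Df cf]]] [g1 [dg [gg Dg cg]]].
exists (fun t => f1 t + g1 t), (fun t => df t + dg t); split.
- by move=> t t01; rewrite ff// gg.
- by move=> t t01; apply: is_derive_add; [exact: Df|exact: Dg].
- exact: within_add.
Qed.

Lemma C1_mul f g : C1_on01 f -> C1_on01 g -> C1_on01 (fun t => f t * g t).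
Proof.
move=> [f1 [df [ff Df cf]]] [g1 [dg [gg Dg cg]]].
exists (fun t => f1 t * g1 t), (fun t => f1 t * dg t + df t * g1 t); split.
- by move=> t t01; rewrite ff// gg.
- by move=> t t01; apply: is_derive_mul; [exact: Df|exact: Dg].
- by apply: within_add; apply: within_mul => //; exact: is_derive_within.
Qed.

Lemma C1_inv f : C1_on01 f -> (forall t : R, t \in `[0, 1] -> f t != 0) ->
  C1_on01 (fun t => (f t)^-1).
Proof.
move=> [g [dg [fg Dg cg]]] f0.
have g0 (t : R) : t \in `[0, 1] -> g t != 0 by move=> t01; rewrite -fg ?f0.
exists (fun t => (g t)^-1), (fun t => - (((g t)^-1 * (g t)^-1) * dg t)); split.
- by move=> t t01; rewrite fg.
- move=> t t01; have := is_deriveV (g0 t t01) (Dg t t01).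
  by rewrite -exprVn expr2 scaleNr.
- have cgi : {within `[0, 1], continuous (fun t => (g t)^-1)}.
    by apply: within_inv => //; exact: is_derive_within Dg.
  by apply: within_opp; apply: within_mul => //; exact: within_mul.
Qed.

Lemma C1_sum (I : Type) (r : seq I) (P : pred I) (f : I -> R -> R) :
  (forall i, C1_on01 (f i)) -> C1_on01 (fun t => \sum_(i <- r | P i) f i t).
Proof.
move=> Cf; elim: r => [|i r IH].
  by apply: (C1_eq _ (C1_cst 0)) => t _; rewrite big_nil.
case Pi: (P i); last by apply: (C1_eq _ IH) => t _; rewrite big_cons Pi.
by apply: (C1_eq _ (C1_add (Cf i) IH)) => t _; rewrite big_cons Pi.
Qed.

Lemma C1_prod (I : Type) (r : seq I) (P : pred I) (f : I -> R -> R) :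
  (forall i, C1_on01 (f i)) -> C1_on01 (fun t => \prod_(i <- r | P i) f i t).
Proof.
move=> Cf; elim: r => [|i r IH].
  by apply: (C1_eq _ (C1_cst 1)) => t _; rewrite big_nil.
case Pi: (P i); last by apply: (C1_eq _ IH) => t _; rewrite big_cons Pi.
by apply: (C1_eq _ (C1_mul (Cf i) IH)) => t _; rewrite big_cons Pi.
Qed.

Lemma C1_smooth f : smooth01 f -> C1_on01 f.
Proof.
move=> [g Dg fg]; exists g, (derive1 g); split => // [t _|].
  exact: derivable_is_derive1 (Dg 0%N t).
by apply: derivable_within_continuous => t _; exact: (Dg 1%N t).
Qed.

Lemma is_derive_sobolev12 f df :
  (forall t : R, t \in `[0, 1] -> is_derive t 1 f (df t)) ->
  {within `[0, 1], continuous df} -> sobolev12 f.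
Proof.
move=> Df cdf; have cf := is_derive_within Df.
have dfE : {in `[0, 1], df =1 derive1 f}.
  by move=> t t01; rewrite (is_derive_derive1 (Df t t01)).
split.
- exact: abs_continuous_derive cdf.
- by apply: aeW => t /Df/is_derive_derivable.
- apply: (@eq_measurable_fun _ _ _ _ _ df); first by move=> t; rewrite inE => /dfE.
  exact: subspace_continuous_measurable_fun.
- apply: (@eq_integrable _ _ _ mu _ _ (fun t => (df t * df t)%:E)) => //.
    by move=> t; rewrite inE => /dfE ->; rewrite expr2.
  by apply: within_integrable; exact: within_mul.
Qed.

Definition C1_mx p q (X : R -> 'M[R]_(p, q)) : Prop :=
  forall i j, C1_on01 (fun t => X t i j).

Definition within_mx p q (X : R -> 'M[R]_(p, q)) : Prop :=
  forall i j, {within `[0, 1], continuous (fun t => X t i j)}.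

Lemma C1_mx_within p q (X : R -> 'M[R]_(p, q)) : C1_mx X -> within_mx X.
Proof. by move=> CX i j; exact: C1_within. Qed.

Lemma C1_mulmx p q r (X : R -> 'M[R]_(p, q)) (Y : R -> 'M[R]_(q, r)) :
  C1_mx X -> C1_mx Y -> C1_mx (fun t => X t *m Y t).
Proof.
move=> CX CY i j; apply: (@C1_eq _ (fun t => \sum_l X t i l * Y t l j)).
  by move=> t _; rewrite mxE.
by apply: C1_sum => l; exact: C1_mul.
Qed.

Lemma C1_cst_mx p q (X : 'M[R]_(p, q)) : C1_mx (fun=> X).
Proof. by move=> i j; exact: C1_cst. Qed.

Lemma C1_trmx p q (X : R -> 'M[R]_(p, q)) : C1_mx X -> C1_mx (fun t => (X t)^T).
Proof. by move=> CX i j; apply: (C1_eq _ (CX j i)) => t _; rewrite mxE. Qed.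

Lemma C1_det p (X : R -> 'M[R]_p) : C1_mx X -> C1_on01 (fun t => \det (X t)).
Proof.
move=> CX; rewrite /determinant; apply: C1_sum => s.
by apply: C1_mul; [exact: C1_cst|apply: C1_prod].
Qed.

Lemma C1_invmx p (X : R -> 'M[R]_p) : C1_mx X ->
  (forall t : R, t \in `[0, 1] -> X t \in unitmx) -> C1_mx (fun t => invmx (X t)).
Proof.
move=> CX uX i j.
apply: (@C1_eq _ (fun t => (\det (X t))^-1 * cofactor (X t) j i)).
  by move=> t t01; rewrite /invmx uX// !mxE.
apply: C1_mul.
  apply: C1_inv; first exact: C1_det.
  by move=> t /uX; rewrite unitmxE unitfE.
rewrite /cofactor; apply: C1_mul; first exact: C1_cst.
apply: C1_det => k l.
by apply: (C1_eq _ (CX (lift j k) (lift i l))) => t _; rewrite !mxE.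
Qed.

Lemma C1_W12_representative d (f : R -> 'cV[R]_d) : C1_mx f ->
  exists2 g : R -> 'cV[R]_d, W12 g & forall t : R, t \in `[0, 1] -> g t = f t.
Proof.
move=> Cf; have /choice[g Hg] : forall i, exists g : R -> R, sobolev12 g /\
    forall t : R, t \in `[0, 1] -> g t = f t i 0.
  move=> i; have [g [dg [fg Dg cg]]] := Cf i 0.
  by exists g; split; [exact: is_derive_sobolev12 Dg cg|move=> t /fg].
exists (fun t => \col_i g i t).
  move=> i; rewrite (_ : (fun _ => _) = g i); first by have [] := Hg i.
  by apply/funext => t; rewrite mxE.
move=> t t01; apply/matrixP => i j; rewrite mxE ord1.
by have [_ ->] := Hg i.
Qed.

End ContinuouslyDifferentiable.

(** * Quadratic forms *)

Section QuadraticForms.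
Context {R : realType}.
Implicit Types p q : nat.

Lemma dotmulC p (x y : 'cV[R]_p) : dotmul x y = dotmul y x.
Proof. by rewrite /dotmul -[x^T *m y]trmxK trmx_mul trmxK mxE. Qed.

Lemma dotmulDl p (x y z : 'cV[R]_p) : dotmul (x + y) z = dotmul x z + dotmul y z.
Proof. by rewrite /dotmul linearD mulmxDl mxE. Qed.

Lemma dotmulDr p (x y z : 'cV[R]_p) : dotmul z (x + y) = dotmul z x + dotmul z y.
Proof. by rewrite /dotmul mulmxDr mxE. Qed.

Lemma dotmulNl p (x y : 'cV[R]_p) : dotmul (- x) y = - dotmul x y.
Proof. by rewrite /dotmul linearN mulNmx mxE. Qed.

Lemma dotmulNr p (x y : 'cV[R]_p) : dotmul x (- y) = - dotmul x y.
Proof. by rewrite /dotmul mulmxN mxE. Qed.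

Lemma dotmul_mulmx p q (M : 'M[R]_(p, q)) (x : 'cV[R]_p) (y : 'cV[R]_q) :
  dotmul x (M *m y) = dotmul (M^T *m x) y.
Proof. by rewrite /dotmul trmx_mul trmxK mulmxA. Qed.

Lemma dotmulE p (x y : 'cV[R]_p) : dotmul x y = \sum_i x i 0 * y i 0.
Proof. by rewrite /dotmul mxE; apply: eq_bigr => i _; rewrite mxE. Qed.

Lemma qform_congruence p q (S : 'M[R]_q) (B : 'M[R]_(p, q)) (x : 'cV[R]_p) :
  qform (B *m S *m B^T) x = qform S (B^T *m x).
Proof. by rewrite /qform -!mulmxA dotmul_mulmx. Qed.

Lemma det0_cV p (S : 'M[R]_p) : S \notin unitmx ->
  exists2 x : 'cV[R]_p, x != 0 & S *m x = 0.
Proof.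
rewrite unitmxE unitfE negbK -det_tr => /det0P[v v0 vS].
exists v^T; last by rewrite -[S]trmxK -trmx_mul vS trmx0.
by apply: contra_neq v0 => /(congr1 trmx); rewrite trmxK trmx0.
Qed.

Lemma posdef_unitmx p (S : 'M[R]_p) : posdef S -> S \in unitmx.
Proof.
move=> pS; apply: contraT => /det0_cV[x x0 Sx].
by have := pS x x0; rewrite /qform Sx /dotmul mulmx0 mxE ltxx.
Qed.

Lemma posdef_ge0 p (S : 'M[R]_p) x : posdef S -> 0 <= qform S x.
Proof.
move=> pS; have [->|x0] := eqVneq x 0; last exact/ltW/pS.
by rewrite /qform mulmx0 /dotmul mulmx0 mxE.
Qed.

(** Twice the Fenchel-Young gap of the convex function [x |-> qform S x / 2], whose
conjugate is [y |-> qform (invmx S) y / 2]. *)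
Definition young_gap p (S : 'M[R]_p) (x y : 'cV[R]_p) : R :=
  qform S x + qform (invmx S) y - 2 * dotmul y x.

Lemma young_gapE p (S : 'M[R]_p) x y : symmetric_mx S -> S \in unitmx ->
  young_gap S x y = qform S (x - invmx S *m y).
Proof.
move=> sS uS; rewrite /young_gap /qform mulmxBr mulKVmx//.
rewrite !dotmulDr !dotmulDl !dotmulNr !dotmulNl.
rewrite [dotmul (invmx S *m y) (S *m x)]dotmul_mulmx sS mulKVmx//.
by rewrite [dotmul x y]dotmulC [dotmul (invmx S *m y) y]dotmulC; ring.
Qed.

Lemma young_gap_ge0 p (S : 'M[R]_p) x y : symmetric_mx S -> posdef S ->
  0 <= young_gap S x y.
Proof.
move=> sS pS; rewrite young_gapE//; first exact: posdef_ge0.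
exact: posdef_unitmx.
Qed.

Lemma young_gap_eq0 p (S : 'M[R]_p) x y : symmetric_mx S -> posdef S ->
  y = S *m x -> young_gap S x y = 0.
Proof.
move=> sS /posdef_unitmx uS ->; rewrite young_gapE// mulKmx// subrr.
by rewrite /qform mulmx0 /dotmul mulmx0 mxE.
Qed.

Lemma within_dotmul d (x y : R -> 'cV[R]_d) : within_mx x -> within_mx y ->
  {within `[0, 1], continuous (fun t => dotmul (x t) (y t))}.
Proof.
move=> cx cy; rewrite (_ : (fun _ => _) = fun t => \sum_i x t i 0 * y t i 0).
  by apply: within_sum => i; exact: within_mul.
by apply/funext => t; rewrite dotmulE.
Qed.

Lemma within_qform d (S : R -> 'M[R]_d) (x : R -> 'cV[R]_d) : within_mx S ->
  within_mx x -> {within `[0, 1], continuous (fun t => qform (S t) (x t))}.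
Proof. by move=> cS cx; apply: within_dotmul => //; exact: within_mulmx. Qed.

Lemma W12_within d (x : R -> 'cV[R]_d) : W12 x -> within_mx x.
Proof. by move=> Wx i j; rewrite ord1; have [/abs_continuous_within] := Wx i. Qed.

End QuadraticForms.

(** * Duality for the linear-quadratic problem *)

Section Duality.
Context {R : realType}.
Local Notation mu := (@lebesgue_measure R).
Variables (p k : nat) (E Pi : 'M[R]_p).
Variables (A Q : R -> 'M[R]_p) (B : R -> 'M[R]_(p, k)) (W : R -> 'M[R]_k).
Hypotheses (E_sym : symmetric_mx E) (E_unit : E \in unitmx).
Hypotheses (Pi_sym : symmetric_mx Pi) (Pi_pos : posdef Pi).
Hypotheses (A_C1 : C1_mx A) (Q_C1 : C1_mx Q) (B_C1 : C1_mx B) (W_C1 : C1_mx W).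
Hypothesis Q_pos : forall t : R, t \in `[0, 1] ->
  symmetric_mx (Q t) /\ posdef (Q t).
Hypothesis W_pos : forall t : R, t \in `[0, 1] ->
  symmetric_mx (W t) /\ posdef (W t).

Definition state_equation (z : R -> 'cV[R]_p) (u : R -> 'cV[R]_k) : Prop :=
  [/\ W12 z, W12 u & {ae mu, forall t : R, t \in `[0, 1] ->
        E *m ddt z t = A t *m z t + B t *m u t}].

Definition costate_equation (rho gam : R -> 'cV[R]_p) : Prop :=
  [/\ W12 rho, W12 gam & {ae mu, forall t : R, t \in `[0, 1] ->
        E *m ddt gam t = - (A t)^T *m gam t + rho t}].

Definition state_cost (z : R -> 'cV[R]_p) (u : R -> 'cV[R]_k) : R :=
  2^-1 * (\int[mu]_(t in `[(0 : R), 1]) (qform (Q t) (z t) + qform (W t) (u t)))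
  + 2^-1 * qform Pi (z 1).

Definition costate_cost (z0 : 'cV[R]_p) (rho gam : R -> 'cV[R]_p) : R :=
  2^-1 * (\int[mu]_(t in `[(0 : R), 1])
            (- qform (invmx (Q t)) (rho t)
             - qform (B t *m invmx (W t) *m (B t)^T) (gam t)))
  - dotmul (gam 0) (E *m z0)
  - 2^-1 * qform (E *m invmx Pi *m E) (gam 1).

Lemma abs_continuous_dotmul d (x y : R -> 'cV[R]_d) :
  (forall i, abs_continuous01 (fun t => x t i 0)) ->
  (forall i, abs_continuous01 (fun t => y t i 0)) ->
  abs_continuous01 (fun t => dotmul (x t) (y t)).
Proof.
move=> acx acy; rewrite (_ : (fun _ => _) = fun t => \sum_i x t i 0 * y t i 0).
  by apply: abs_continuous_sum => i; exact: abs_continuous_mul.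
by apply/funext => t; rewrite dotmulE.
Qed.

Lemma W12_is_derive d (x : R -> 'cV[R]_d) : W12 x ->
  {ae mu, forall t : R, t \in `[0, 1] ->
     forall i, is_derive t 1 (fun s => x s i 0) (ddt x t i 0)}.
Proof.
move=> Wx.
have H : {ae mu, forall t : R, forall i, t \in `[0, 1] ->
    derivable (fun s => x s i 0) t 1}.
  apply: (@filter_forall _ _ (fun i (t : R) =>
    t \in `[0, 1] -> derivable (fun s : R => x s i 0) t 1) _
    (ae_filter_ringOfSetsType mu)) => i.
  by have [] := Wx i.
apply: filterS H; first exact: (ae_filter_ringOfSetsType mu).
by move=> t H t01 i; rewrite mxE; exact: derivable_is_derive1 (H i t01).
Qed.

(** The terms with [A] cancel in the derivative of [gam . E z] because [E] is
symmetric and the costate equation involves [- A^T]. *)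
Lemma adjoint_pairing z u rho gam :
  state_equation z u -> costate_equation rho gam ->
  \int[mu]_(t in `[(0 : R), 1]) (dotmul (rho t) (z t) + dotmul ((B t)^T *m gam t) (u t))
    = dotmul (gam 1) (E *m z 1) - dotmul (gam 0) (E *m z 0).
Proof.
move=> [Wz Wu ez] [Wr Wg eg].
apply: (@weak_FTC _ (fun t => dotmul (gam t) (E *m z t))).
- apply: abs_continuous_dotmul => i; first by have [] := Wg i.
  rewrite (_ : (fun _ => _) = fun t => \sum_j E i j * z t j 0); last first.
    by apply/funext => t; rewrite mxE.
  apply: abs_continuous_sum => j; apply: abs_continuous_mul.
    exact: abs_continuous_cst.
  by have [] := Wz j.
- apply: within_add; apply: within_dotmul; try exact: W12_within.
  apply: within_mulmx; last exact: W12_within.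
  exact/C1_mx_within/C1_trmx.
have Fae := ae_filter_ringOfSetsType mu.
have Dzg : {ae mu, forall t : R, t \in `[0, 1] ->
    (forall i, is_derive t 1 (fun s => z s i 0) (ddt z t i 0)) /\
    (forall i, is_derive t 1 (fun s => gam s i 0) (ddt gam t i 0))}.
  apply: (@filterS2 _ _ Fae _ _ _ _ (W12_is_derive Wz)
    (W12_is_derive Wg)) => t Dz Dg t01.
  by split; [exact: Dz|exact: Dg].
apply: (@filterS3 _ _ Fae _ _ _ _ _ ez eg Dzg) => t {}ez {}eg {}Dzg t01.
have [Dz Dg] := Dzg t01.
rewrite (_ : (fun _ => _) = fun t => 
    \sum_i gam t i 0 * \sum_j E i j * z t j 0); last first.
  by apply/funext => s; rewrite dotmulE; apply: eq_bigr => i _; rewrite mxE.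
have -> : dotmul (rho t) (z t) + dotmul ((B t)^T *m gam t) (u t) =
   \sum_i (gam t i 0 * (\sum_j (E i j * ddt z t j 0 + 0 * z t j 0))
      + ddt gam t i 0 * (\sum_j E i j * z t j 0)).
  have -> : \sum_i (gam t i 0 * (\sum_j (E i j * ddt z t j 0 + 0 * z t j 0))
      + ddt gam t i 0 * (\sum_j E i j * z t j 0)) =
      dotmul (gam t) (E *m ddt z t) + dotmul (ddt gam t) (E *m z t).
    rewrite !dotmulE -big_split/=; apply: eq_bigr => i _.
    rewrite !(mxE, @mxE _ p 1 _ (fun i j => \sum_l E i l * z t l j)).
    congr (_ * _ + _); apply: eq_bigr => j _; by rewrite mul0r addr0 ?mxE.
  rewrite (dotmul_mulmx E (ddt gam t)) E_sym ez// eg//.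
  rewrite dotmulDr dotmulDl mulNmx dotmulNl !dotmul_mulmx; ring.
apply: is_derive_bigsum => i; apply: is_derive_mul (Dg i) _.
by apply: is_derive_bigsum => j; exact: is_derive_mul (is_derive_const _ _) (Dz j).
Qed.

Lemma within_invQ : within_mx (fun t => invmx (Q t)).
Proof.
by apply/C1_mx_within/C1_invmx => // t /Q_pos[_]; exact: posdef_unitmx.
Qed.

Lemma C1_invW : C1_mx (fun t => invmx (W t)).
Proof. by apply: C1_invmx => // t /W_pos[_]; exact: posdef_unitmx. Qed.

(** By [adjoint_pairing] the cross terms of the three gaps, among which the terminal
one is [2 * dotmul (gam 1) (E *m z 1)], add up to [2 * dotmul (gam 0) (E *m z 0)],
the contribution of the initial value to the dual cost. *)
Lemma duality_gap z u rho gam :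
  state_equation z u -> costate_equation rho gam ->
  2 * (state_cost z u - costate_cost (z 0) rho gam) =
  \int[mu]_(t in `[(0 : R), 1])
     (young_gap (Q t) (z t) (rho t) + young_gap (W t) (u t) ((B t)^T *m gam t))
  + young_gap Pi (z 1) (- (E *m gam 1)).
Proof.
move=> sz cg; have pair := adjoint_pairing sz cg.
have [Wz Wu _] := sz; have [Wr Wg _] := cg.
have cz := W12_within Wz; have cu := W12_within Wu.
have cr := W12_within Wr; have cgam := W12_within Wg.
have cBg : within_mx (fun t => (B t)^T *m gam t).
  by apply: within_mulmx => //; exact/C1_mx_within/C1_trmx.
pose f1 t := qform (Q t) (z t) + qform (W t) (u t).
pose f2 t := - qform (invmx (Q t)) (rho t)
  - qform (B t *m invmx (W t) *m (B t)^T) (gam t).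
pose f3 t := dotmul (rho t) (z t) + dotmul ((B t)^T *m gam t) (u t).
have cf1 : {within `[0, 1], continuous f1}.
  by apply: within_add; apply: within_qform => //; exact: C1_mx_within.
have cf2 : {within `[0, 1], continuous f2}.
  apply: within_add; apply: within_opp; apply: within_qform => //.
    exact: within_invQ.
  apply/C1_mx_within/C1_mulmx; last exact: C1_trmx.
  by apply: C1_mulmx => //; exact: C1_invW.
have cf3 : {within `[0, 1], continuous f3}.
  by apply: within_add; apply: within_dotmul.
have cf3' : {within `[0, 1], continuous (fun t => 2 * f3 t)}.
  by apply: within_mul => //; exact: within_cst.
have cf12 : {within `[0, 1], continuous (fun t => f1 t - f2 t)}.
  by apply: within_add => //; exact: within_opp.
have -> : \int[mu]_(t in `[(0 : R), 1])
     (young_gap (Q t) (z t) (rho t) + young_gap (W t) (u t) ((B t)^T *m gam t)) =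
    \int[mu]_(t in `[(0 : R), 1]) (f1 t - f2 t - 2 * f3 t).
  apply: eq_Rintegral => t _.
  by rewrite /f1 /f2 /f3 /young_gap qform_congruence; ring.
rewrite RintegralB//; [|exact: within_integrable..].
rewrite RintegralB//; [|exact: within_integrable..].
rewrite RintegralZl//; last exact: within_integrable.
rewrite pair /state_cost /costate_cost -/f1 -/f2 /young_gap.
have -> : qform (E *m invmx Pi *m E) (gam 1) = qform (invmx Pi) (- (E *m gam 1)).
  rewrite -{2}E_sym qform_congruence E_sym /qform mulmxN dotmulNl dotmulNr; ring.
have -> : dotmul (- (E *m gam 1)) (z 1) = - dotmul (gam 1) (E *m z 1).
  by rewrite dotmulNl dotmul_mulmx E_sym.
set I1 := \int[mu]_(_ in _) f1 _; set I2 := \int[mu]_(_ in _) f2 _.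
by field.
Qed.

Lemma weak_duality z u rho gam : state_equation z u -> costate_equation rho gam ->
  costate_cost (z 0) rho gam <= state_cost z u.
Proof.
move=> sz cg; rewrite -subr_ge0 -(pmulr_rge0 _ (ltr0n R 2)) (duality_gap sz cg).
apply: addr_ge0; last exact: young_gap_ge0.
apply: Rintegral_ge0 => t t01; have [? ?] := Q_pos t01; have [? ?] := W_pos t01.
by apply: addr_ge0; exact: young_gap_ge0.
Qed.

Lemma tight_duality z u rho gam : state_equation z u -> costate_equation rho gam ->
  (forall t : R, t \in `[0, 1] -> rho t = Q t *m z t) ->
  (forall t : R, t \in `[0, 1] -> (B t)^T *m gam t = W t *m u t) ->
  E *m gam 1 = - (Pi *m z 1) ->
  state_cost z u = costate_cost (z 0) rho gam.
Proof.
move=> sz cg rhoE uE endE; apply/eqP; rewrite -subr_eq0.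
have := duality_gap sz cg; rewrite young_gap_eq0//; last by rewrite endE opprK.
rewrite (@eq_Rintegral _ _ _ _ _ (fun=> 0)) ?addr0; last first.
  move=> t; rewrite inE/= => t01; have [? ?] := Q_pos t01; have [? ?] := W_pos t01.
  by rewrite !young_gap_eq0// ?addr0 ?rhoE ?uE.
rewrite Rintegral_cst// mul0r => /eqP; rewrite mulf_eq0 => /orP[|//].
by rewrite pnatr_eq0.
Qed.

(** The coefficient matrix of the system for [col_mx z gam] obtained by substituting
[u = W^-1 B^T gam] and [rho = Q z] in the state and costate equations. *)
Definition hamiltonian (t : R) : 'M[R]_(p + p) :=
  block_mx (invmx E *m A t) (invmx E *m (B t *m invmx (W t) *m (B t)^T))
           (invmx E *m Q t) (- (invmx E *m (A t)^T)).

Lemma hamiltonian_within : within_mx hamiltonian.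
Proof.
have CE q (X : R -> 'M[R]_(p, q)) : C1_mx X -> within_mx (fun t => invmx E *m X t).
  by move=> CX; apply/C1_mx_within/C1_mulmx => //; exact: C1_cst_mx.
have c1 := CE _ _ A_C1; have c3 := CE _ _ Q_C1; have c4 := CE _ _ (C1_trmx A_C1).
have c2 : within_mx (fun t => invmx E *m (B t *m invmx (W t) *m (B t)^T)).
  apply: CE; apply: C1_mulmx; last exact: C1_trmx.
  by apply: C1_mulmx => //; exact: C1_invW.
move=> i j; rewrite /hamiltonian.
case: (split_ordP i) => i' ->; case: (split_ordP j) => j' ->.
- by rewrite (_ : (fun _ => _) = fun t => (invmx E *m A t) i' j')//;
    apply/funext => t; rewrite block_mxEul.
- rewrite (_ : (fun _ => _) = fun t =>
      (invmx E *m (B t *m invmx (W t) *m (B t)^T)) i' j')//.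
  by apply/funext => t; rewrite block_mxEur.
- by rewrite (_ : (fun _ => _) = fun t => (invmx E *m Q t) i' j')//;
    apply/funext => t; rewrite block_mxEdl.
- rewrite (_ : (fun _ => _) = fun t => - (invmx E *m (A t)^T) i' j').
    by apply: within_opp; exact: c4.
  by apply/funext => t; rewrite block_mxEdr mxE.
Qed.

(** The Hamiltonian system, with derivatives at every point of [0, 1]. *)
Definition extremal (z gam : R -> 'cV[R]_p) : Prop :=
  forall t : R, t \in `[0, 1] -> forall i,
    is_derive t 1 (fun s => z s i 0)
      ((invmx E *m (A t *m z t + B t *m (invmx (W t) *m ((B t)^T *m gam t)))) i 0) /\
    is_derive t 1 (fun s => gam s i 0)
      ((invmx E *m (- (A t)^T *m gam t + Q t *m z t)) i 0).

(** The control [W^-1 B^T gam] and the multiplier [Q z] are continuously differentiable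
on [0, 1] only in the sense of [C1_mx], hence the passage to representatives. *)
Lemma extremal_equations z gam : extremal z gam ->
  exists u rho, [/\ state_equation z u, costate_equation rho gam,
    forall t : R, t \in `[0, 1] -> rho t = Q t *m z t &
    forall t : R, t \in `[0, 1] -> (B t)^T *m gam t = W t *m u t].
Proof.
move=> ex.
pose dz t := invmx E *m (A t *m z t + B t *m (invmx (W t) *m ((B t)^T *m gam t))).
pose dg t := invmx E *m (- (A t)^T *m gam t + Q t *m z t).
have cz : within_mx z.
  by move=> i j; rewrite ord1; apply: is_derive_within => t /ex/(_ i)[].
have cg : within_mx gam.
  by move=> i j; rewrite ord1; apply: is_derive_within => t /ex/(_ i)[_].
have cadd (X Y : R -> 'cV[R]_p) : within_mx X -> within_mx Y ->
    within_mx (fun t => X t + Y t).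
  move=> cX cY i j; rewrite (_ : (fun _ => _) = fun t => X t i j + Y t i j).
    exact: within_add.
  by apply/funext => t; rewrite mxE.
have cE (X : R -> 'cV[R]_p) : within_mx X -> within_mx (fun t => invmx E *m X t).
  by move=> cX; apply: within_mulmx => // i j; exact: within_cst.
have cBg : within_mx (fun t => (B t)^T *m gam t).
  by apply: within_mulmx => //; exact/C1_mx_within/C1_trmx.
have cdz : within_mx dz.
  apply: cE; apply: cadd; apply: within_mulmx => //; try exact: C1_mx_within.
  by apply: within_mulmx => //; exact/C1_mx_within/C1_invW.
have cdg : within_mx dg.
  apply: cE; apply: cadd; apply: within_mulmx => //; last exact: C1_mx_within.
  move=> i j; rewrite (_ : (fun _ => _) = fun t => - (A t)^T i j).
    by apply: within_opp; exact: (C1_mx_within (C1_trmx A_C1)).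
  by apply/funext => t; rewrite mxE.
have Cz : C1_mx z.
  move=> i j; rewrite ord1; exists (fun t => z t i 0), (fun t => dz t i 0).
  by split => // t /ex/(_ i)[].
have Cg : C1_mx gam.
  move=> i j; rewrite ord1; exists (fun t => gam t i 0), (fun t => dg t i 0).
  by split => // t /ex/(_ i)[].
have Wz : W12 z.
  by move=> i; apply: (@is_derive_sobolev12 _ _ (fun t => dz t i 0)) => //
    t /ex/(_ i)[].
have Wg : W12 gam.
  by move=> i; apply: (@is_derive_sobolev12 _ _ (fun t => dg t i 0)) => //
    t /ex/(_ i)[].
have [u Wu uE] := C1_W12_representative
  (C1_mulmx C1_invW (C1_mulmx (C1_trmx B_C1) Cg)).
have [rho Wr rE] := C1_W12_representative (C1_mulmx Q_C1 Cz).
exists u, rho; split => //.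
- split => //; apply: aeW => t t01; rewrite uE//.
  rewrite (_ : ddt z t = dz t) ?mulKVmx//; apply/matrixP => i j.
  by rewrite mxE ord1; have [/is_derive_derive1] := ex t t01 i.
- split => //; apply: aeW => t t01; rewrite rE//.
  rewrite (_ : ddt gam t = dg t) ?mulKVmx//; apply/matrixP => i j.
  by rewrite mxE ord1; have [_ /is_derive_derive1] := ex t t01 i.
- move=> t t01; rewrite uE// mulKVmx//.
  by have [_ /posdef_unitmx] := W_pos t01.
Qed.

(** The pairing equates [- z(1) . Pi z(1)], which is negative unless [z(1) = 0], with
the integral of a nonnegative function. *)
Lemma homogeneous_extremal z gam : extremal z gam -> z 0 = 0 ->
  E *m gam 1 = - (Pi *m z 1) -> z 1 = 0 /\ gam 1 = 0.
Proof.
move=> ex z0 endE.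
have [u [rho [sz cg rhoE uE]]] := extremal_equations ex.
have pair := adjoint_pairing sz cg.
have z1 : z 1 = 0.
  apply/eqP; apply: contraT => z1; have := Pi_pos z1.
  suff : qform Pi (z 1) <= 0 by rewrite leNgt => /negbTE ->.
  rewrite -oppr_ge0 /qform -dotmulNr -endE dotmulC.
  rewrite (_ : dotmul _ _ = dotmul (gam 1) (E *m z 1)); last first.
    by rewrite dotmul_mulmx E_sym.
  rewrite -[leRHS]subr0 -[X in _ - X](_ : dotmul (gam 0) (E *m z 0) = 0); last first.
    by rewrite z0 mulmx0 /dotmul mulmx0 mxE.
  rewrite -pair; apply: Rintegral_ge0 => t t01.
  have [_ Qp] := Q_pos t01; have [_ Wp] := W_pos t01.
  by rewrite rhoE// uE// ![dotmul (_ *m _) _]dotmulC addr_ge0//; exact: posdef_ge0.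
split => //; move: endE; rewrite z1 mulmx0 oppr0 => /(congr1 (mulmx (invmx E))).
by rewrite mulKmx// mulmx0.
Qed.

(** If [c] is the coordinate vector of a solution in a fundamental matrix, the
boundary data depend on [c] through the square matrix [L], which is invertible by
[homogeneous_extremal]. *)
Lemma extremal_exists z0 : exists z gam, [/\ extremal z gam, z 0 = z0 &
  E *m gam 1 = - (Pi *m z 1)].
Proof.
have [Phi HPhi] := fundamental_matrix hamiltonian_within.
pose z c t : 'cV[R]_p := usubmx (Phi t *m c).
pose g c t : 'cV[R]_p := dsubmx (Phi t *m c).
have ex (c : 'cV[R]_(p + p)) : extremal (z c) (g c).
  move=> t t01 i; have [_ DP] := HPhi t t01.
  have Dx l : is_derive t 1 (fun s => (Phi s *m c) l 0)
      ((hamiltonian t *m (Phi t *m c)) l 0).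
    rewrite mulmxA mxE; under eq_fun do rewrite mxE.
    have D := is_derive_bigsum (index_enum _) xpredT
      (fun j => is_derive_mul (DP l j) (is_derive_const t (c j 0))).
    rewrite (eq_bigr (fun j => Phi t l j * 0 + (hamiltonian t *m Phi t) l j * c j 0))//.
    by move=> j _; rewrite mulr0 add0r.
  have HE : hamiltonian t *m (Phi t *m c) = col_mx
      (invmx E *m (A t *m z c t + B t *m (invmx (W t) *m ((B t)^T *m g c t))))
      (invmx E *m (- (A t)^T *m g c t + Q t *m z c t)).
    rewrite -{1}[Phi t *m c]vsubmxK mul_block_col; congr col_mx.
      by rewrite mulmxDr !mulmxA.
    by rewrite mulmxDr addrC mulNmx [in RHS]mulNmx mulmxN !mulmxA.
  split.
  - rewrite (_ : (fun s => z c s i 0) = fun s => (Phi s *m c) (lshift p i) 0).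
      by have := Dx (lshift p i); rewrite HE col_mxEu.
    by apply/funext => s; rewrite mxE.
  - rewrite (_ : (fun s => g c s i 0) = fun s => (Phi s *m c) (rshift p i) 0).
      by have := Dx (rshift p i); rewrite HE col_mxEd.
    by apply/funext => s; rewrite mxE.
have i0 : (0 : R) \in `[0, 1] by rewrite in_itv/= lexx ler01.
have i1 : (1 : R) \in `[0, 1] by rewrite in_itv/= lexx ler01.
pose L : 'M[R]_(p + p) :=
  col_mx (usubmx (Phi 0)) (E *m dsubmx (Phi 1) + Pi *m usubmx (Phi 1)).
have LE c : L *m c = col_mx (z c 0) (E *m g c 1 + Pi *m z c 1).
  by rewrite mul_col_mx mulmxDl -!mulmxA /z /g -!mul_usub_mx -!mul_dsub_mx.
have uL : L \in unitmx.
  apply: contraT => /det0_cV[c c0]; rewrite LE => L0.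
  have [zc0] : z c 0 = 0 /\ E *m g c 1 + Pi *m z c 1 = 0.
    by apply: eq_col_mx; rewrite L0 col_mx0.
  move=> /eqP; rewrite addr_eq0 => /eqP endE.
  have [z1 g1] := homogeneous_extremal (ex c) zc0 endE.
  have /eqP : Phi 1 *m c = 0 by rewrite -[LHS]vsubmxK -/(z c 1) -/(g c 1) z1 g1 col_mx0.
  have [u1 _] := HPhi 1 i1.
  by move=> /eqP /(congr1 (mulmx (invmx (Phi 1)))); rewrite mulKmx// mulmx0 => /eqP;
    rewrite (negbTE c0).
have := LE (invmx L *m col_mx z0 0); rewrite mulKVmx// => /eq_col_mx[zE gE].
exists (z (invmx L *m col_mx z0 0)), (g (invmx L *m col_mx z0 0)); split => //.
by apply/eqP; rewrite -addr_eq0 -gE.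
Qed.

Theorem strong_duality z0 : exists z u rho gam,
  [/\ state_equation z u, z 0 = z0, costate_equation rho gam &
      state_cost z u = costate_cost z0 rho gam].
Proof.
have [z [gam [ex zE endE]]] := extremal_exists z0.
have [u [rho [sz cg rhoE uE]]] := extremal_equations ex.
exists z, u, rho, gam; split => //.
by rewrite -zE; exact: tight_duality.
Qed.

End Duality.

(** * The singularly perturbed problem *)

Lemma Ieps_sym (R : realType) (m n : nat) (e : R) : symmetric_mx (Ieps m n e).
Proof. by rewrite /symmetric_mx /Ieps tr_block_mx !trmx0 trmx1 tr_scalar_mx. Qed.

Lemma Ieps_unit (R : realType) (m n : nat) (e : R) : e != 0 ->
  Ieps m n e \in unitmx.
Proof.
move=> e0; rewrite unitmxE /Ieps det_ublock det1 det_scalar mul1r.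
by rewrite unitfE expf_neq0.
Qed.

Theorem mainTheorem1 (R : realType) (m n k : nat)
    (hm : (0 < m)%N) (hn : (0 < n)%N) (hk : (0 < k)%N)
    (es : R) (hes : 0 < es)
    (D : lq_data R m n k) (K : lq_coefs R m n k)
    (hD : standing_assumptions es D K)
    (hfeas : forall e : R, e \in `]0, es] ->
       exists (z : R -> 'cV[R]_(m + n)) (u : R -> 'cV[R]_k),
         primal_feasible D e z u) :
  forall e : R, e \in `]0, es] ->
    exists VP VD : R,
      [/\ primal_value D e VP, dual_value D e VD & VP = VD].
Proof.
move=> e e_range.
have [e_gt0 e_les] : 0 < e /\ e <= es by move: e_range; rewrite in_itv/= => /andP[].
have e_range0 : e \in `[0, es] by rewrite in_itv/= (ltW e_gt0).
have [Qs Rs As bs] := sa_b hD e_range0.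
have smoothC1 p q (X : R -> 'M[R]_(p, q)) : smooth01_mx X -> C1_mx X.
  by move=> sX i j; exact: C1_smooth (sX i j).
have Es := Ieps_sym m n e; have Eu := Ieps_unit m n (lt0r_neq0 e_gt0).
have [Pis _] := sa_f_pi hD e_range0; have Pip := sa_f_pi_pos hD e_range.
have Qp t (t01 : t \in `[0, 1]) := sa_f_Q hD t01 e_range0.
have Rp t (t01 : t \in `[0, 1]) := sa_d hD t01 e_range0.
have [z [u [rho [gam [sz z0E cg VE]]]]] := strong_duality Es Eu Pis Pip
  (smoothC1 _ _ _ As) (smoothC1 _ _ _ Qs) (smoothC1 _ _ _ bs) (smoothC1 _ _ _ Rs)
  Qp Rp (dz0 D e).
have weak := weak_duality Es Pis Pip (smoothC1 _ _ _ Qs) (smoothC1 _ _ _ bs)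
  (smoothC1 _ _ _ Rs) Qp Rp.
exists (primal_cost D e z u), (dual_cost D e rho gam); split; last exact: VE.
- split; first by exists z, u; split => //; case: sz.
  move=> z' u' [Wz' Wu' sz' z0'].
  have := weak _ _ _ _ _ (And3 Wz' Wu' sz') cg; rewrite z0'.
  by apply: le_trans; rewrite -[leRHS]VE.
- split; first by exists rho, gam.
  move=> rho' gam' cg'; have := weak _ _ _ _ _ sz cg'; rewrite z0E => /le_trans; apply.
  by rewrite [leLHS]VE.
Qed.
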